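(* Consider the risk process $R(t)=u+ct-\sum_{k=1}^{N(t)}Y_k$ with multivariate phase-type claims with parameters $\bm{\alpha}$, $(A_k)_{k\ge1}$, $(D_k)_{k\ge1}$, as defined in the context, with $u\ge0$. Assume that there are an integer $p<\infty$ and reals $\nu<\infty$, $\sigma>0$ such that: (A1) the dimensions of $A_1,A_2,\dots$ are bounded by $p$; (A2) the sequence $\max_i(-A_1\bm{1})_i,\ \max_i(-A_2\bm{1})_i,\dots$ is bounded from above by $\nu$; (A3) the dominating eigenvalues of $A_1,A_2,\dots$ are bounded from above by $-\sigma<0$. Let $\{L_i\}_{i\ge1}$ and $\{H_i\}_{i\ge1}$ be two i.i.d. sequences, independent of $\{N(t)\}$, with $L_i\sim\mathrm{Exp}(\nu)$ and $H_i\sim\mathrm{Erlang}(p,\sigma)$, and define $$R_L(t)=u+ct-\sum_{k=1}^{N(t)}L_k,\qquad R_H(t)=u+ct-\sum_{k=1}^{N(t)}H_k,$$ with the same $u$, $c$ and $\{N(t)\}$ as for $R$. Then $$\mathbb{P}\Big(\inf_{t\ge0}R_L(t)<0\,\Big|\,R_L(0)=u\Big)\le\mathbb{P}\Big(\inf_{t\ge0}R(t)<0\,\Big|\,R(0)=u\Big)\le\mathbb{P}\Big(\inf_{t\ge0}R_H(t)<0\,\Big|\,R_H(0)=u\Big).$$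
   Context: $\bm{1}$, $\bm{0}$ are vectors of ones and zeros of appropriate size. Claims. For $k\ge1$ let $\mathcal{S}_k$ be a finite nonempty set, $A_k$ a square matrix indexed by $\mathcal{S}_k$ with nonnegative off-diagonal entries, and $D_k$ a nonnegative $|\mathcal{S}_k|\times|\mathcal{S}_{k+1}|$ matrix, with $A_k\bm{1}+D_k\bm{1}=\bm{0}$ and $A_k$ invertible (the states of $\mathcal{S}_k$ are transient); let $\bm{\alpha}$ be a probability row vector on $\mathcal{S}_1$. The sequence $\{Y_k\}_{k\ge1}$ is such that for every $n\ge1$, $(Y_1,\dots,Y_n)$ is distributed as the vector of times spent successively in $\mathcal{S}_1,\dots,\mathcal{S}_n$ by a Markov jump process $\varphi$ on $\{\star\}\cup\mathcal{S}_1\cup\cdots\cup\mathcal{S}_n$ ($\star$ absorbing) started in $\mathcal{S}_1$ with distribution $\bm{\alpha}$, whose transition rates are $A_k$ within $\mathcal{S}_k$ ($k\le n$), $D_k$ from $\mathcal{S}_k$ to $\mathcal{S}_{k+1}$ ($k<n$), $D_n\bm{1}$ from $\mathcal{S}_n$ to $\star$, and no others; i.e. $Y_k=\int_0^\infty\mathbf{1}_{\{\varphi(s)\in\mathcal{S}_k\}}ds$. Risk process. $R(t)=u+ct-\sum_{k=1}^{N(t)}Y_k$, where $c>0$, $\{N(t)\}$ is a Poisson process of intensity $\lambda>0$, and for all $n\ge1$ the vector $(Y_1,\dots,Y_n)$ is independent of $\{N(t)\}$. The dominating eigenvalue of a square matrix is the eigenvalue with the largest real part; for each sub-generator $A_k$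 it is real and strictly negative. $\mathrm{Exp}(\nu)$ is the exponential distribution with rate $\nu$; $\mathrm{Erlang}(p,\sigma)$ is the law of the sum of $p$ independent $\mathrm{Exp}(\sigma)$ variables. *)

(* Defs.v *)
From HB Require Import structures.
From mathcomp Require Import all_boot all_order all_algebra.
From mathcomp Require Import complex.
From mathcomp Require Import all_classical all_reals all_analysis.
From mathcomp Require Import measurable_realfun.

Set Implicit Arguments.
Unset Strict Implicit.
Unset Printing Implicit Defensive.

Import Order.TTheory GRing.Theory Num.Theory.
Import numFieldNormedType.Exports.

Local Open Scope classical_set_scope.
Local Open Scope ring_scope.

(* The sequences indexed by k >= 1 in the mathematical text (claims, phase
   blocks, matrices) are indexed here by k >= 0. *)

Section Independence.
Context {d : measure_display} {T : measurableType d} {R : realType}.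
Variable P : probability T R.

Definition process_sigma_algebra (I : Type) (J : set I) (d' : measure_display)
    (T' : measurableType d') (X : I -> T -> T') : set (set T) :=
  <<s \bigcup_(i in J) preimage_set_system setT (X i) measurable >>.

Definition independent_sigma_algebras (F G : set (set T)) : Prop :=
  forall A B, F A -> G B -> P (A `&` B) = (P A * P B)%E.

Definition mutually_independent (I : eqType) (d' : measure_display)
    (T' : measurableType d') (X : I -> T -> T') : Prop :=
  forall (s : seq I) (B : I -> set T'),
    uniq s -> (forall i, measurable (B i)) ->
    P (\big[setI/setT]_(i <- s) (X i @^-1` B i)) =
      (\prod_(i <- s) P (X i @^-1` B i))%E.

Definition conditional_probability (A B : set T) : R :=
  fine (P (A `&` B)) / fine (P B).

(* Laws are compared on measurable sets only: measures are total functions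
   here, with no meaning on the other sets. *)
Definition exponential_rv (rate : R) (X : {RV P >-> R}) : Prop :=
  forall B : set R, measurable B -> distribution P X B = exponential_prob rate B.

End Independence.

Definition erlang_rv (d : measure_display) (T : measurableType d)
    (R : realType) (P : probability T R) (p : nat) (rate : R)
    (X : {RV P >-> R}) : Prop :=
  exists (d' : measure_display) (T' : measurableType d')
    (P' : probability T' R) (E : 'I_p -> {RV P' >-> R}),
    [/\ mutually_independent P' (fun j => E j : T' -> R),
        forall j, exponential_rv rate (E j)
      & forall B : set R, measurable B ->
          distribution P X B =
          P' ((fun w => \sum_(j < p) E j w) @^-1` B)].

Section PoissonProcess.
Context {d : measure_display} {T : measurableType d} {R : realType}.
Variable P : probability T R.

Record poisson_process (rate : R) (N : R -> T -> nat) : Prop := {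
  poisson_process_measurable :
    forall t, 0 <= t -> measurable_fun [set: T] (N t);
  poisson_process_start : forall w, N 0 w = 0%N;
  poisson_process_nondecreasing :
    forall w s t, 0 <= s -> s <= t -> (N s w <= N t w)%N;
  poisson_process_right_continuous :
    forall w t, 0 <= t -> \forall s \near t^'+, N s w = N t w;
  poisson_process_increments :
    forall s t k, 0 <= s -> s < t ->
      P [set w | (N t w - N s w)%N = k] = (poisson_pmf (rate * (t - s)) k)%:E;
  poisson_process_independent_increments :
    forall t : nat -> R, 0 <= t 0%N -> {homo t : i j / (i <= j)%N >-> i <= j} ->
      mutually_independent P (fun i w => (N (t i.+1) w - N (t i) w)%N)
}.

End PoissonProcess.

Section MarkovJumpProcess.
Context {R : realType}.

Definition expmx (n : nat) (M : 'M[R]_n) : 'M[R]_n :=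
  \matrix_(i, j) limn (series (fun k => (M ^+ k) i j / k`!%:R)).

Section FiniteStateSpace.
Variable E : finType.

Definition generator_mx (q : E -> E -> R) : 'M[R]_#|E| :=
  \matrix_(i, j) q (enum_val i) (enum_val j).

Definition transition_probability (q : E -> E -> R) (t : R) (x y : E) : R :=
  expmx (t *: generator_mx q) (enum_rank x) (enum_rank y).

Context {d : measure_display} {T : measurableType d}.
Variable P : probability T R.

(* Off the diagonal q x y is the jump rate from x to y, and every row of q
   sums to 0.  On a finite discrete state space, having right-continuous paths
   with left limits means making finitely many jumps in bounded time. *)
Record markov_jump_process (mu : E -> R) (q : E -> E -> R)
    (phi : R -> T -> E) : Prop := {
  mjp_measurable : forall t x, 0 <= t -> measurable [set w | phi t w = x];
  mjp_right_continuous :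
    forall w t, 0 <= t -> \forall s \near t^'+, phi s w = phi t w;
  mjp_left_limits :
    forall w t, 0 < t -> exists x, \forall s \near t^'-, phi s w = x;
  mjp_finite_dimensional_laws :
    forall (n : nat) (t : nat -> R) (x : nat -> E),
      t 0%N = 0 -> {homo t : i j / (i <= j)%N >-> i <= j} ->
      P [set w | forall i, (i <= n)%N -> phi (t i) w = x i] =
        (mu (x 0%N) * \prod_(i < n)
           transition_probability q (t i.+1 - t i) (x i) (x i.+1))%:E
}.

End FiniteStateSpace.
End MarkovJumpProcess.

Section PhaseTypeClaims.
Context {R : realType}.
Variable m : nat -> nat.
Variable A : forall k, 'M[R]_(m k).
Variable D : forall k, 'M[R]_(m k, m k.+1).
Variable alpha : 'rV[R]_(m 0%N).

Record phase_type_parameters : Prop := {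
  ptp_nonempty : forall k, (0 < m k)%N;
  ptp_off_diagonal : forall k i j, i != j -> 0 <= A k i j;
  ptp_nonnegative : forall k i j, 0 <= D k i j;
  ptp_row_sums :
    forall k, A k *m const_mx 1 + D k *m const_mx 1 = 0 :> 'cV_(m k);
  ptp_transient : forall k, A k \in unitmx;
  ptp_initial_nonnegative : forall i, 0 <= alpha 0 i;
  ptp_initial_total : \sum_i alpha 0 i = 1
}.

(* [None] is the absorbing state; [Some] of the pair (k, i) is the i-th phase
   of the k-th block. *)
Definition phase_state (n : nat) : finType := option {k : 'I_n & 'I_(m k)}.

Definition in_block (n : nat) (k : 'I_n) (x : phase_state n) : bool :=
  if x is Some y then tag y == k else false.

(* [block_value k f y] is f i if y is the i-th phase of block k, and 0 if y is
   in another block.  Forgetting that the block number of y is bounded by n lets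
   [untag] do this without type casts. *)
Definition block_value (n k : nat) (f : 'I_(m k) -> R)
    (y : {l : 'I_n & 'I_(m l)}) : R :=
  @untag nat (fun l => 'I_(m l)) R 0 k f
    (Tagged (fun l : nat => 'I_(m l)) (tagged y)).

Definition initial_law (n : nat) (x : phase_state n) : R :=
  if x is Some y then block_value (fun i : 'I_(m 0%N) => alpha 0 i) y else 0.

Definition phase_rate (n : nat) (x y : phase_state n) : R :=
  match x, y with
  | None, _ => 0
  | Some x', None =>
      if (tag x').+1 == n
      then (D (tag x') *m (const_mx 1 : 'cV_(m (tag x').+1))) (tagged x') 0
      else 0
  | Some x', Some y' =>
      block_value (fun j : 'I_(m (tag x')) => A (tag x') (tagged x') j) y'
      + block_value (fun j : 'I_(m (tag x').+1) => D (tag x') (tagged x') j) y'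
  end.

Definition occupation_time (n : nat) (T : Type) (phi : R -> T -> phase_state n)
    (k : 'I_n) (w : T) : \bar R :=
  (\int[lebesgue_measure]_(s in `[0%R, +oo[)
     (\1_[set s | in_block k (phi s w)] s)%:E)%E.

(* The time spent in a block is only almost surely finite, so the joint laws
   are compared as laws on vectors of extended reals. *)
Definition phase_type_claims (d : measure_display) (T : measurableType d)
    (P : probability T R) (Y : nat -> {RV P >-> R}) : Prop :=
  forall n : nat, (0 < n)%N ->
  exists (d' : measure_display) (T' : measurableType d')
    (P' : probability T' R) (phi : R -> T' -> phase_state n),
    markov_jump_process P' (@initial_law n) (@phase_rate n) phi /\
    forall B : set (n.-tuple (\bar R)), measurable B ->
      P ((fun w => [tuple (Y k w)%:E | k < n]) @^-1` B) =
      P' ((fun w => [tuple occupation_time phi k w | k < n]) @^-1` B).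

End PhaseTypeClaims.

Definition dominating_eigenvalue (R : realType) (n : nat) (M : 'M[R]_n)
    (z : R[i]) : Prop :=
  let MC := map_mx (real_complex R) M in
  eigenvalue MC z /\
  forall z' : R[i], eigenvalue MC z' -> complex.Re z' <= complex.Re z.

Section RiskProcess.
Context {d : measure_display} {T : measurableType d} {R : realType}.
Variable P : probability T R.

Definition risk_process (u c : R) (N : R -> T -> nat)
    (Y : nat -> {RV P >-> R}) (t : R) (w : T) : R :=
  u + c * t - \sum_(k < N t w) Y k w.

Definition ruin_event (X : R -> T -> R) : set T :=
  [set w | (ereal_inf [set (X t w)%:E | t in [set t : R | (0 <= t)%R]] < 0)%E].

Definition ruin_probability (X : R -> T -> R) (u : R) : R :=
  conditional_probability P (ruin_event X) [set w | X 0 w = u].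

End RiskProcess.

(* Main.v *)
Require Import Defs.
From HB Require Import structures.
From mathcomp Require Import all_boot all_order all_algebra.
From mathcomp Require Import complex.
From mathcomp Require Import all_classical all_reals all_analysis.
From mathcomp Require Import measurable_realfun.
From mathcomp Require Import ring lra.
Set Implicit Arguments.
Unset Strict Implicit.
Unset Printing Implicit Defensive.

Import Order.TTheory GRing.Theory Num.Theory.
Import numFieldNormedType.Exports.
Local Open Scope classical_set_scope.
Local Open Scope ring_scope.

(** Ruin means that some partial sum of claims exceeds the level u + c t while
    exactly that many claims have arrived by time t.  Conditionally on finitely
    many values of the counting process, staying solvent therefore means that
    the partial sums S_1, S_2, ... meet nondecreasing deadlines,
    S_(l+1) <= a_l for all l < n.  So it is enough to compare, for the three
    sequences of claims, the probability of meeting such deadlines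
    ([ruin_probability_le]).

    For phase-type claims S_(l+1) is the instant at which the jump process
    leaves block l, so meeting the deadlines says where the process is at the
    fixed times a_0, ..., a_(n-1) ([occupation_deadlines]).  By the Markov
    property the probability is governed by value functions: F_k(s, i), the
    probability of meeting the remaining deadlines when phase i of block k is
    occupied at time s, solves F_k' = - A_k F_k - D_k F_(k+1) up to the deadline
    a_k, where it vanishes ([phase_deadlines]).  For sums of independent
    exponential variables of rate r, conditioning on one variable at a time
    gives value functions w_b that solve w_b' = r (w_b - w_(b+1))
    ([deadlines_block_stages]).  Both systems are compared backward in time by a
    maximum principle ([backward_comparison]).

    Lower bound: every phase is left for the next block at rate at most nu, and
    w_b is increasing in b, so one Exp(nu) stage per block is faster
    ([exponential_upper_bound]).

    Upper bound: for s < sigma there is a vector v > 0 with A_k v <= - s v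
    ([exists_supersolution]).  If i minimises v on a set C of phases, then the
    time needed to leave C from i is stochastically smaller than Exp(s), because
    v / v_i dominates 1 on C and decays at rate s.  After one such stage the
    process is outside C, at worst in a phase removed from C earlier; removing
    the phases one by one uses at most p stages per block
    ([exponential_stages_lower_bound]).  When A_k is reducible there may be no
    such v for s = sigma.  The passage from s to sigma is made in the deadlines:
    slowing the stages down by s / sigma amounts to multiplying the deadlines by
    s / sigma, and the probability of meeting deadlines is right continuous in
    them ([met_deadlines_right_continuous]). *)

(** * Calculus and measure theory *)

Lemma is_derive_continuous (R : realType) (g : R -> R) (x dg : R) :
  is_derive x 1 g dg -> {for x, continuous g}.
Proof. by move=> [] /derivable1_diffP/differentiable_continuous. Qed.

Lemma is_derive_right_min (R : realType) (f : R -> R) (c b df : R) : c < b ->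
  is_derive c 1 f df -> (forall s, c <= s <= b -> f c <= f s) -> 0 <= df.
Proof.
move=> cb fdf fmin.
have /cvg_ex[l fl] := @ex_derive _ _ _ _ _ _ _ fdf.
have dfl : l = df by rewrite -(@derive_val _ _ _ _ _ _ _ fdf); apply/esym/cvg_lim.
rewrite -{}dfl.
have {}fl : h^-1 *: (f (h *: 1 + c) - f c) @[h --> 0^'+] --> l.
  exact: cvg_dnbhs_at_right fl.
rewrite -(cvg_lim _ fl)//; apply: limr_ge; first by apply/cvg_ex; exists l.
near=> h.
have h0 : 0 < h by near: h; exact: nbhs_right_gt.
rewrite /GRing.scale /= mulr1 mulr_ge0 ?invr_ge0 ?(ltW h0)// subr_ge0 fmin//.
rewrite lerDr (ltW h0)/= -lerBrDr ltW//.
by near: h; apply: nbhs_right_lt; rewrite subr_gt0.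
Unshelve. all: by end_near. Qed.

Lemma within_continuousM {R : realType} (D : set R) (f g : R -> R) :
  {within D, continuous f} -> {within D, continuous g} ->
  {within D, continuous (fun x => f x * g x)}.
Proof. by move=> cf cg x; apply: continuousM; [exact: cf|exact: cg]. Qed.

Lemma is_derive_fin_sum (R : realType) (I : finType) (h : I -> R -> R)
    (dh : I -> R) (s : R) :
  (forall i, is_derive s 1 (h i) (dh i)) ->
  is_derive s 1 (fun t => \sum_i h i t) (\sum_i dh i).
Proof.
move=> hd; rewrite (_ : (fun t => _) = \sum_i h i); last first.
  by apply/funext => t; rewrite fct_sumE.
elim/big_ind2 : _ => // [|f df g dg fd gd]; first exact: is_derive_cst.
exact: is_deriveD.
Qed.

Lemma exists_primitive (R : realType) (h : R -> R) (c : R) : continuous h ->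
  exists G : R -> R, forall y, c < y -> is_derive y 1 G (h y).
Proof.
move=> hc; exists (fun x => \int[lebesgue_measure]_(t in `[c, x]) h t) => y cy.
have yu : y < y + 1 by rewrite ltrDl.
have hi : lebesgue_measure.-integrable `[c, y + 1] (EFin \o h).
  apply: continuous_compact_integrable; first exact: segment_compact.
  exact: continuous_subspaceT.
have [dG GE] := continuous_FTC1_closed yu hi cy (hc y).
by apply: DeriveDef => //; rewrite -derive1E.
Qed.

Lemma measurable_le_set d (T : measurableType d) (R : realType) (f : T -> R) (c : R) :
  measurable_fun setT f -> measurable [set z | f z <= c].
Proof.
move=> mf; rewrite -[X in measurable X]setTI.
rewrite (_ : [set z | _] = f @^-1` `]-oo, c]); first exact: mf.
by apply/seteqP; split => z /=; rewrite in_itv.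
Qed.

Lemma measurable_lt0 d (T : measurableType d) (R : realType) (X : T -> R) : measurable_fun setT X ->
  measurable [set w | X w < 0].
Proof.
move=> mX; rewrite (_ : [set w | _] = ~` [set w | - X w <= 0]); last first.
  by apply/seteqP; split=> w /=; rewrite oppr_le0 ltNge => /negP.
by apply: measurableC; apply: measurable_le_set; exact: measurable_funN.
Qed.

Lemma measurable_forall_lt d (T : measurableType d) (n : nat)
    (F : nat -> set T) :
  (forall l, (l < n)%N -> measurable (F l)) ->
  measurable [set z | forall l, (l < n)%N -> F l z].
Proof.
move=> mF; rewrite [X in measurable X](_ : _ =
    \bigcap_l [set z | (l < n)%N -> F l z]); last first.
  by apply/seteqP; split => z h l; [move=> _; exact: h|exact: (h l I)].
apply: bigcapT_measurable => l; have [ln|nl] := ltnP l n.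
  rewrite [X in measurable X](_ : _ = F l); first exact: mF.
  by apply/seteqP; split => z h //; exact: h.
by rewrite [X in measurable X](_ : _ = setT)//; apply/seteqP; split.
Qed.

Lemma measurable_fibers d (T : measurableType d) (E : finType) (Z : T -> E)
    (G : pred E) :
  (forall y, measurable [set w | Z w = y]) -> measurable [set w | G (Z w)].
Proof.
move=> mZ; rewrite (_ : [set w | _] =
    \bigcup_(y in [set` [seq y <- enum E | G y]]) [set w | Z w = y]).
  by apply: fin_bigcup_measurable => // ; exact: finite_seq.
apply/seteqP; split => w /=.
  by move=> GZ; exists (Z w) => //=; rewrite mem_filter GZ mem_enum.
by move=> [y /=]; rewrite mem_filter => /andP[Gy _] ->.
Qed.

Lemma probability_partition d (T : measurableType d) (R : realType)
    (P : probability T R) (E : finType) (Z : T -> E) (F : set T) :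
  (forall y, measurable [set w | Z w = y]) -> measurable F ->
  (P F = \sum_y P (F `&` [set w | Z w = y]))%E.
Proof.
move=> mZ mF.
have {1}-> : F = \bigcup_(y in [set` enum E]) (F `&` [set w | Z w = y]).
  apply/seteqP; split => w; last by case=> y _ [].
  by exists (Z w) => //=; rewrite mem_enum.
rewrite measure_fin_bigcup; last 3 first.
- exact: finite_seq.
- by move=> x y _ _ [w [[_ /= <-] [_ /= <-]]].
- by move=> y _; exact: measurableI.
by rewrite -fsbig_seq ?enum_uniq// big_enum.
Qed.

Lemma eq_indic (R : pzRingType) (S T : Type) (A : set S) (B : set T) s t :
  (A s <-> B t) -> \1_A s = \1_B t :> R.
Proof.
move=> AB; rewrite !indicE; have [As|nAs] := pselect (A s).
  by rewrite !mem_set//; exact/AB.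
by rewrite !memNset// => /AB.
Qed.

Lemma probability_eq_off_null d (T : measurableType d) (R : realType)
    (P : probability T R) (N V V' : set T) :
  measurable N -> P N = 0%E -> measurable V -> measurable V' ->
  (forall w, ~ N w -> V w <-> V' w) -> P V = P V'.
Proof.
move=> mN N0 mV mV' VV'.
have le U U' : measurable U -> measurable U' ->
    (forall w, ~ N w -> U w -> U' w) -> (P U <= P U')%E.
  move=> mU mU' UU'.
  apply: (@le_trans _ _ (P (U' `|` N))); last first.
    apply: le_trans (measureU2 _ mU' mN) _.
    by rewrite [X in (_ + X <= _)%E]N0 adde0.
  apply: le_measure; rewrite ?inE//; first exact: measurableU.
  by move=> w Uw; have [Nw|nNw] := pselect (N w); [right|left; exact: UU'].
by apply/eqP; rewrite eq_le !le// => w /VV'[].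
Qed.

(** * A maximum principle for linear differential inequalities *)

Section MaximumPrinciple.
Context {R : realType}.

(** Parabolic maximum principle: at a negative space-time minimum of the
    weighted functions e^s Z_i(s), attained before the final time, the
    nonnegative off-diagonal rates and the weight force a negative derivative,
    whereas a minimum over later times has a nonnegative one. *)
Lemma backward_comparison (I : finType) (C : pred I) (A : I -> I -> R)
    (Z dZ : R -> I -> R) (a : R) :
  (forall i j, i != j -> 0 <= A i j) ->
  (forall i, C i -> \sum_(j | C j) A i j <= 0) ->
  (forall i, C i -> {within `[0, a], continuous (Z ^~ i)}) ->
  (forall i s, C i -> 0 <= s < a -> is_derive s 1 (Z ^~ i) (dZ s i)) ->
  (forall i s, C i -> 0 <= s < a -> dZ s i <= - \sum_(j | C j) A i j * Z s j) ->
  (forall i, C i -> 0 <= Z a i) ->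
  forall i s, C i -> 0 <= s <= a -> 0 <= Z s i.
Proof.
move=> A0 rowA cZ dZE dZle Za i0 s0 Ci0 s0a.
have a0 : 0 <= a by case/andP: s0a => /le_trans; apply.
(* The weight turns the row sums, which are at most 0, into at most -1. *)
pose z i s := expR s * Z s i.
have cz i : C i -> {within `[0, a], continuous (z i)}.
  move=> Ci x; apply: continuousM; last exact: cZ.
  by apply: continuous_subspaceT; exact: continuous_expR.
have /choice[m mP] i : exists m, C i ->
    m \in `[0, a] /\ forall s, s \in `[0, a] -> z i m <= z i s.
  have [Ci|_] := boolP (C i); last by exists 0.
  by have [m m1 m2] := EVT_min a0 (cz i Ci); exists m.
have [i Ci zmin] := @arg_minP _ _ _ i0 C (fun i => z i (m i)) Ci0.
have [mi zi] := mP i Ci.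
have zge j s : C j -> s \in `[0, a] -> z i (m i) <= z j s.
  move=> Cj sa; apply: le_trans (zmin j Cj) _.
  by have [_] := mP j Cj; exact.
suff zi0 : 0 <= z i (m i).
  have := zge i0 s0 Ci0; rewrite in_itv/= => /(_ s0a) /(le_trans zi0).
  by rewrite pmulr_rge0// expR_gt0.
rewrite leNgt; apply/negP => zneg.
have := mi; rewrite in_itv/= => /andP[mi0].
rewrite le_eqVlt => /predU1P[mia|mia].
  by move: zneg; rewrite ltNge /z mia mulr_ge0 ?expR_ge0 ?Za.
have mi0a : 0 <= m i < a by rewrite mi0.
have dz : is_derive (m i) 1 (z i) (expR (m i) * (Z (m i) i + dZ (m i) i)).
  have := dZE i _ Ci mi0a => H; apply: is_derive_eq.
  by rewrite /GRing.scale /= mulrDr addrC [Z _ _ * _]mulrC.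
have : 0 <= expR (m i) * (Z (m i) i + dZ (m i) i).
  apply: is_derive_right_min mia dz _ => s /andP[s1 s2].
  by apply: zi; rewrite in_itv/= s2 (le_trans mi0).
rewrite pmulr_rge0 ?expR_gt0//; apply/negP; rewrite -ltNge.
rewrite (le_lt_trans (lerD (lexx _) (dZle _ _ Ci mi0a)))//.
rewrite subr_lt0; move: zneg; rewrite /z pmulr_rlt0 ?expR_gt0// => Zneg.
apply: (lt_le_trans Zneg).
have Zge j : C j -> Z (m i) i <= Z (m i) j.
  by move=> Cj; have := zge j _ Cj mi; rewrite /z ler_pM2l ?expR_gt0.
apply: (@le_trans _ _ (\sum_(j | C j) A i j * Z (m i) i)).
  by rewrite -mulr_suml mulr_le0 ?rowA// ltW.
apply: ler_sum => j Cj; have [->//|ij] := eqVneq i j.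
by rewrite ler_wpM2l ?A0 ?Zge.
Qed.
End MaximumPrinciple.

(** * Comparing the exit of a block with exponential stages *)

Section ExponentialComparison.
Context {R : realType} {I : finType}.
Variables (A : I -> I -> R) (F r : R -> I -> R) (a : R).
Hypothesis A_ge0 : forall i j, i != j -> 0 <= A i j.
Hypothesis A_row : forall i, \sum_j A i j <= 0.
Hypothesis F_cont : forall i, {within `[0, a], continuous (F ^~ i)}.
Hypothesis F_ode : forall i s, 0 <= s < a ->
  is_derive s 1 (F ^~ i) (- (\sum_j A i j * F s j) - r s i).

Lemma ge0_sub_row (C : pred I) (v : I -> R) i : C i -> (forall j, 0 <= v j) ->
  \sum_(j | C j) A i j * v j <= \sum_j A i j * v j.
Proof.
move=> Ci v0; rewrite [leRHS](bigID C)/= lerDl sumr_ge0// => j Cj.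
rewrite mulr_ge0 ?v0// A_ge0//.
by apply: contraNneq Cj => <-.
Qed.

(** F_i is the probability of success starting from phase i, and r collects the
    inflow from the next block, where success has probability at most W.  The
    difference w - F satisfies the maximum principle because a phase is left at
    rate at most nu and w <= W: leaving later is worse. *)
Lemma exponential_upper_bound (nu : R) (w W : R -> R) :
  (forall i, - \sum_j A i j <= nu) ->
  {within `[0, a], continuous w} ->
  (forall s, 0 <= s < a -> is_derive s 1 w (nu * (w s - W s))) ->
  (forall s, 0 <= s < a -> w s <= W s) ->
  (forall i s, 0 <= s < a -> r s i <= - (\sum_j A i j) * W s) ->
  (forall i, F a i <= w a) ->
  forall i s, 0 <= s <= a -> F s i <= w s.
Proof.
move=> Anu wc wE wW rW Fa i s sa; rewrite -subr_ge0.
apply: (@backward_comparison _ _ xpredT A (fun s i => w s - F s i)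
  (fun s i => nu * (w s - W s) - (- (\sum_j A i j * F s j) - r s i)) a) => //.
- move=> {}i _ x; apply: continuousB; [exact: wc|exact: F_cont].
- move=> {}i {}s _ {}sa; have := wE s sa; have := F_ode i sa => ? ?.
  exact: is_deriveB.
- move=> {}i {}s _ {}sa.
  have -> : \sum_j A i j * (w s - F s j) =
      (\sum_j A i j) * w s - \sum_j A i j * F s j.
    by rewrite mulr_suml -sumrB; apply: eq_bigr => j _; rewrite mulrBr.
  have := rW i s sa; have := wW s sa; have := Anu i; nra.
- by move=> {}i _; rewrite subr_ge0.
Qed.

Section OneStage.
Variables (sigma : R) (v : I -> R) (f g df : R -> R) (C : pred I) (i : I).
Hypothesis v_gt0 : forall j, 0 < v j.
Hypothesis Av : forall j, \sum_l A j l * v l <= - sigma * v j.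

(** The comparison function is f - (f - g) v / v_i on C.  It equals g at the
    phase i, it is at most g elsewhere on C because i minimises v there, so that
    it is nonpositive at the final time, and A v <= - sigma v makes it a
    subsolution. *)
Lemma exponential_stage_lower_bound :
  C i -> (forall j, C j -> v i <= v j) ->
  {within `[0, a], continuous f} -> {within `[0, a], continuous g} ->
  (forall s, 0 <= s < a -> is_derive s 1 f (df s)) ->
  (forall s, 0 <= s < a -> is_derive s 1 g (sigma * (g s - f s))) ->
  (forall s, 0 <= s < a -> df s <= 0) ->
  (forall s, 0 <= s < a -> g s <= f s) -> 0 <= f a -> g a = 0 ->
  (forall j s, 0 <= s < a -> - (\sum_l A j l) * f s <= r s j) ->
  (forall j s, ~~ C j -> 0 <= s < a -> f s <= F s j) ->
  (forall j, 0 <= F a j) ->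
  forall s, 0 <= s <= a -> g s <= F s i.
Proof.
move=> Ci vi fc gc fE gE df0 gf fa ga rf Ff Fa s0 s0a.
pose Z s j := F s j - f s + (v j / v i) * (f s - g s).
suff : 0 <= Z s0 i.
  by rewrite /Z divff ?gt_eqF// mul1r; lra.
apply: (@backward_comparison _ _ C A Z (fun s j =>
  (- (\sum_l A j l * F s l) - r s j) - df s +
  (v j / v i) * (df s - sigma * (g s - f s))) a) => //.
- move=> j Cj; apply: le_trans (A_row j).
  have := ge0_sub_row Cj (v := fun=> 1) (fun=> ler01).
  by under eq_bigr do rewrite mulr1; under [leRHS]eq_bigr do rewrite mulr1.
- move=> j Cj; apply: within_continuousD.
    by apply: within_continuousB; [exact: F_cont|exact: fc].
  apply: within_continuousM; last by apply: within_continuousB.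
  by apply: continuous_subspaceT => x; exact: cst_continuous.
- move=> j s Cj sa; have := F_ode j sa; have := fE s sa; have := gE s sa.
  by move=> ? ? ?; apply: is_derive_eq.
- move=> j s Cj sa.
  have -> : \sum_(l | C l) A j l * Z s l =
      \sum_(l | C l) A j l * F s l - (\sum_(l | C l) A j l) * f s +
      (\sum_(l | C l) A j l * v l) * ((f s - g s) / v i).
    rewrite !mulr_suml -sumrB -big_split/=; apply: eq_bigr => l _.
    by rewrite /Z; ring.
  have fg : 0 <= (f s - g s) / v i by rewrite divr_ge0 ?subr_ge0 ?gf// ltW.
  have h1 : (\sum_(l | C l) A j l * v l) * ((f s - g s) / v i) <=
      (- sigma * v j) * ((f s - g s) / v i).
    rewrite ler_wpM2r//; apply: le_trans (Av j).
    by apply: ge0_sub_row => // l; rewrite ltW.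
  have h2 : \sum_(l | ~~ C l) A j l * f s <= \sum_(l | ~~ C l) A j l * F s l.
    apply: ler_sum => l Cl; rewrite ler_wpM2l ?Ff// A_ge0//.
    by apply: contraNneq Cl => <-.
  have h3 : df s * (v j / v i - 1) <= 0.
    by rewrite mulr_le0_ge0 ?df0// subr_ge0 ler_pdivlMr// mul1r vi.
  have := rf j s sa; rewrite -mulr_suml in h2.
  rewrite (bigID C)/= [in X in _ -> X](bigID C)/=.
  lra.
- move=> j Cj; rewrite /Z ga subr0 -addrA addr_ge0//.
  have : 1 <= v j / v i by rewrite ler_pdivlMr// mul1r vi.
  nra.
Qed.
End OneStage.

(** Induction on the set C of phases not treated yet: while j phases have been
    treated, success from any of them is at least as likely as success with j
    stages left, and the minimiser of v on C is treated next. *)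
Lemma exponential_stages_lower_bound (sigma : R) (v : I -> R)
    (g dg : nat -> R -> R) :
  (forall j, 0 < v j) ->
  (forall j, \sum_l A j l * v l <= - sigma * v j) ->
  (forall k, {within `[0, a], continuous (g k)}) ->
  (forall k s, 0 <= s < a -> is_derive s 1 (g k) (dg k s)) ->
  (forall k s, 0 <= s < a -> dg k s <= 0) ->
  (forall k s, 0 <= s < a -> dg k.+1 s = sigma * (g k.+1 s - g k s)) ->
  (forall k s, 0 <= s < a -> g k.+1 s <= g k s) ->
  0 <= g 0%N a -> (forall k, g k.+1 a = 0) ->
  (forall j s, 0 <= s < a -> - (\sum_l A j l) * g 0%N s <= r s j) ->
  (forall j, 0 <= F a j) ->
  forall j s, 0 <= s < a -> g #|I| s <= F s j.
Proof.
move=> v0 Av gc gE dg0 dgE gle g0a ga rg Fa.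
have gmono k s : 0 <= s < a -> g k s <= g 0%N s.
  by move=> sa; elim: k => // k; apply: le_trans; exact: gle.
suff H n (C : {set I}) k : #|C| = n -> (n + k = #|I|)%N ->
    (forall j s, j \notin C -> 0 <= s < a -> g k s <= F s j) ->
    forall j s, 0 <= s < a -> g #|I| s <= F s j.
  apply: (H #|I| [set: I]%SET 0%N); rewrite ?cardsT ?addn0// => j s.
  by rewrite inE.
elim: n C k => [|n IHn] C k Cn nk Fk.
  move: Cn nk => /cards0_eq C0; rewrite add0n => <- j s; apply: Fk.
  by rewrite C0 inE.
have /card_gt0P[i0 Ci0] : (0 < #|C|)%N by rewrite Cn.
have [i Ci vi] := @arg_minP _ _ _ i0 (fun i => i \in C) v Ci0.
apply: (IHn (C :\ i)%SET k.+1).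
- by have := cardsD1 i C; rewrite Cn Ci add1n => -[<-].
- by rewrite addnS -addSn.
move=> j s jC sa; have [Cj|Cj] := boolP (j \in C); last first.
  by apply: le_trans (gle k s sa) _; exact: Fk.
have -> : j = i by move: jC; rewrite !inE Cj andbT negbK => /eqP.
have gka : 0 <= g k a by case: k {nk Fk} => // k; rewrite ga.
have gE' t : 0 <= t < a -> is_derive t 1 (g k.+1) (sigma * (g k.+1 t - g k t)).
  by move=> ta; rewrite -dgE//; exact: gE.
have rg' l t : 0 <= t < a -> - (\sum_m A l m) * g k t <= r t l.
  move=> ta; apply: le_trans (rg l t ta); apply: ler_wpM2l (gmono k t ta).
  by rewrite oppr_ge0.
have sa' : 0 <= s <= a by case/andP: sa => -> /ltW.
exact: (exponential_stage_lower_bound v0 Av Ci vi (gc k) (gc k.+1) (gE k) gE'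
  (dg0 k) (gle k) gka (ga k) rg' (fun l t => @Fk l t) Fa sa').
Qed.

End ExponentialComparison.

(** * Positive supersolutions from the dominating eigenvalue *)

Section DominatingEigenvalue.
Context {R : realType} {n : nat}.
Implicit Types A : 'M[R]_n.

(** Eigenvalues are the roots of a split polynomial, hence finite in number. *)
Lemma exists_dominating_eigenvalue A : (0 < n)%N ->
  exists z, dominating_eigenvalue A z.
Proof.
move=> n0; pose MC := map_mx (real_complex R) A.
have [r rE] := closed_field_poly_normal (char_poly MC).
have {}rE z : eigenvalue MC z = (z \in r).
  rewrite eigenvalue_root_char rE rootZ ?root_prod_XsubC//.
  by rewrite lead_coef_eq0 -size_poly_eq0 size_char_poly.
have r0 : (0 < size r)%N.
  have [z] : exists z, root (char_poly MC) z.
    apply/closed_rootP; rewrite size_char_poly.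
    by case: (n) n0.
  by rewrite -eigenvalue_root_char rE; case: (r).
have [i _ imax] := @arg_maxP _ _ _ (Ordinal r0) xpredT
  (fun i : 'I_(size r) => complex.Re r`_i) isT.
exists r`_i; split; first by rewrite -/MC rE mem_nth.
move=> z; rewrite -/MC rE => /(nthP 0)[k kr <-].
exact: (imax (Ordinal kr)).
Qed.

Lemma root_char_poly_le A (b t : R) :
  (forall z, dominating_eigenvalue A z -> complex.Re z <= b) ->
  root (char_poly A) t -> t <= b.
Proof.
move=> Ab tA; have n0 : (0 < n)%N.
  rewrite lt0n; apply: contraTneq tA => n0; apply/rootP.
  have : size (char_poly A) = 1%N by rewrite size_char_poly n0.
  move=> /eqP/size_poly1P[c c0 ->]; rewrite hornerC; exact/eqP.
have [z zA] := exists_dominating_eigenvalue A n0.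
apply: le_trans (Ab z zA).
suff /(zA.2) : eigenvalue (map_mx (real_complex R) A) (real_complex R t) by [].
by rewrite eigenvalue_root_char -map_char_poly fmorph_root.
Qed.

(** Take v(t) = (t - A)^-1 1 with t = - s.  The resolvent is continuous for
    t > - sigma, where t - A is invertible.  No entry of v(t) can reach 0 while
    the others are nonnegative, since the corresponding row of A v = t v - 1
    would then have a nonnegative left-hand side and the right-hand side -1.
    Diagonal dominance gives v(t) > 0 for t > 0, and the intermediate value
    theorem, applied to the smallest entry, carries positivity down to - s. *)
Lemma exists_supersolution A (sigma s : R) :
  (forall i j, i != j -> 0 <= A i j) ->
  (forall i, \sum_j A i j <= 0) ->
  (forall z, dominating_eigenvalue A z -> complex.Re z <= - sigma) ->
  s < sigma ->
  exists v : 'I_n -> R, (forall j, 0 < v j) /\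
    (forall i, \sum_j A i j * v j <= - s * v i).
Proof.
move=> A0 Arow Asigma ssigma.
have chi0 t : - sigma < t -> (char_poly A).[t] != 0.
  apply: contraTN => tA; rewrite -leNgt; exact: root_char_poly_le Asigma tA.
pose U := \adj (char_poly_mx A) *m (const_mx 1 : 'cV_n).
pose v i t := (U i 0).[t] / (char_poly A).[t].
have vE i t : - sigma < t -> \sum_j A i j * v j t = t * v i t - 1.
  move=> /chi0 t0.
  have UE : \sum_j char_poly_mx A i j * U j 0 = char_poly A.
    have /matrixP/(_ i 0) : char_poly_mx A *m U =
        (char_poly A)%:M *m (const_mx 1 : 'cV_n).
      by rewrite mulmxA mul_mx_adj.
    by rewrite mul_scalar_mx !mxE mulr1.
  have {}UE : t * (U i 0).[t] - \sum_j A i j * (U j 0).[t] = (char_poly A).[t].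
    have XE j : char_poly_mx A i j = 'X *+ (i == j) - (A i j)%:P by rewrite !mxE.
    rewrite -[in RHS]UE horner_sum.
    under [RHS]eq_bigr => j _ do
      rewrite hornerM XE hornerD hornerN hornerC hornerMn hornerX mulrBl.
    rewrite sumrB; congr (_ - _).
    rewrite (bigD1 i)//= eqxx mulr1n big1 ?addr0// => j.
    by rewrite eq_sym => /negbTE ->; rewrite mulr0n mul0r.
  rewrite /v; under eq_bigr do rewrite mulrA.
  rewrite -mulr_suml -[X in _ - X](divff t0) mulrA -[X in _ - X / _]UE mulrBl.
  by rewrite opprB addrC subrK.
suff vpos : forall t, - sigma < t -> forall i, 0 < v i t.
  have ss : - sigma < - s by rewrite ltrN2.
  exists (v^~ (- s)); split; first exact: vpos.
  by move=> i; rewrite vE// lerBlDr lerDl.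
pose f t := \big[Num.min/1]_i v i t.
have f_neq0 t : - sigma < t -> f t != 0.
  move=> ts; apply/eqP => f0.
  have /bigmin_leP[|[i _ vi]] : f t <= 0 by rewrite f0.
    by rewrite real_leNgt ?ltr01.
  have vge j : 0 <= v j t by rewrite -f0; exact: bigmin_le.
  have vi0 : v i t = 0 by apply/eqP; rewrite eq_le vi vge.
  have := vE i t ts; rewrite vi0 mulr0 sub0r => E.
  have : 0 <= \sum_j A i j * v j t.
    apply: sumr_ge0 => j _; have [<-|ij] := eqVneq i j; first by rewrite vi0 mulr0.
    by rewrite mulr_ge0// A0.
  by rewrite E oppr_ge0 ler10.
have f_gt0 t : - sigma < t -> 0 < t -> 0 < f t.
  move=> ts t0; rewrite ltNge; apply/negP => ft.
  have [i0 vi0] : exists i, v i t < 0.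
    apply: contrapT => H; move: ft; rewrite leNgt => /negP; apply.
    rewrite lt_neqAle eq_sym f_neq0//=; apply: le_bigmin => // i _.
    by rewrite leNgt; apply/negP => vi; apply: H; exists i.
  have [i _ vi] := @arg_minP _ _ _ i0 xpredT (v^~ t) isT.
  have vineg : v i t < 0 by apply: le_lt_trans vi0; exact: vi.
  have := vE i t ts.
  have : (\sum_j A i j) * v i t <= \sum_j A i j * v j t.
    rewrite mulr_suml; apply: ler_sum => j _; have [<-//|ij] := eqVneq i j.
    by rewrite ler_wpM2l ?A0// vi.
  have := Arow i; nra.
have fcont t : - sigma < t -> {for t, continuous f}.
  move=> ts.
  have -> : f = \big[(fun g h => g \min h)/cst 1]_i v i.
    apply/funext => x; rewrite /f.
    by elim/big_rec2 : _ => // i y g _ ->.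
  elim/big_rec : _ => [|i g _ gc]; first exact: cst_continuous.
  apply: continuous_min => //.
  apply: continuousM; first exact: continuous_horner.
  by apply: continuousV; [exact: chi0|exact: continuous_horner].
have fpos t : - sigma < t -> 0 < f t.
  move=> ts; have [t1|t1] := leP 1 t; first by rewrite f_gt0// (lt_le_trans _ t1).
  rewrite ltNge; apply/negP => ft.
  have f1 : 0 < f 1 by rewrite f_gt0// (lt_trans ts).
  have [| |c] := @IVT _ f t 1 0 (ltW t1).
  - apply: continuous_in_subspaceT => x; rewrite inE/= in_itv/= => /andP[tx _].
    by apply: fcont; apply: lt_le_trans tx.
  - by rewrite ge_min ft/= le_max (ltW f1) orbT.
  rewrite in_itv/= => /andP[tc _]; apply/eqP/f_neq0.
  exact: lt_le_trans tc.
by move=> t ts i; apply: lt_le_trans (fpos t ts) _; exact: bigmin_le.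
Qed.

End DominatingEigenvalue.

(** * The matrix exponential *)

Section MatrixExponential.
Context {R : realType} {n : nat}.
Implicit Types M : 'M[R]_n.

Definition entry_sum M : R := \sum_i \sum_j `|M i j|.

(** The crude bound by powers of the sum of all entries makes every power series
    below converge on the whole line. *)
Lemma expr_mx_entry_le M k i j : `|(M ^+ k) i j| <= entry_sum M ^+ k.
Proof.
have s0 : 0 <= entry_sum M by rewrite !sumr_ge0// => ? _; rewrite sumr_ge0.
elim: k i j => [|k IH] i j.
  rewrite (_ : M ^+ 0 = 1%:M)// expr0 mxE.
  by case: (i == j); rewrite ?normr1 ?normr0.
rewrite (_ : M ^+ k.+1 = M *m M ^+ k); last by rewrite exprS.
rewrite mxE.
apply: le_trans (ler_norm_sum _ _ _) _.
rewrite exprS [X in X * _]/entry_sum [X in X * _](bigD1 i)//= mulrDl.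
rewrite (@le_trans _ _ ((\sum_j `|M i j|) * entry_sum M ^+ k))//; last first.
  by rewrite lerDl mulr_ge0 ?exprn_ge0// sumr_ge0// => ? _; rewrite sumr_ge0.
rewrite mulr_suml ler_sum// => l _; rewrite normrM.
by rewrite ler_wpM2l.
Qed.

Lemma cvg_exp_pseries (d : nat -> R) (B C t : R) : 0 <= C ->
  (forall k, `|d k| <= B * C ^+ k) ->
  cvgn (pseries (fun k => d k / k`!%:R) t).
Proof.
move=> C0 dB; apply: normed_cvg.
have B0 : 0 <= B by have := dB 0%N; rewrite expr0 mulr1; exact: le_trans.
apply: (@series_le_cvg _ _ (fun k => B * exp_coeff (C * `|t|) k)) => //=.
- by move=> k; rewrite mulr_ge0// exp_coeff_ge0// mulr_ge0.
- move=> k; rewrite /exp_coeff/= exprMn !normrM normfV normrX.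
  rewrite (ger0_norm (ler0n R k`!)) mulrAC 2!mulrA ler_wpM2r ?invr_ge0//.
  by rewrite ler_wpM2r ?exprn_ge0.
- exact: (is_cvg_seriesZ (k := B) (is_cvg_series_exp_coeff (C * `|t|))).
Qed.

Lemma pseries_diffs_fact (d : nat -> R) :
  pseries_diffs (fun k => d k / k`!%:R) = (fun k => d k.+1 / k`!%:R).
Proof.
apply/funext => k; rewrite /pseries_diffs factS natrM invfM.
by rewrite mulrCA mulVKf// pnatr_eq0.
Qed.

Lemma expmx_scale M i j t :
  expmx (t *: M) i j = limn (pseries (fun k => (M ^+ k) i j / k`!%:R) t).
Proof.
rewrite mxE /pseries; congr (limn (series _)); apply/funext => k.
suff -> : (t *: M) ^+ k = t ^+ k *: M ^+ k by rewrite mxE -mulrA mulrC.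
elim: k => [|k IH]; first by rewrite !expr0 scale1r.
rewrite !exprS IH -[_ * _]/((t *: M) *m (t ^+ k *: M ^+ k)).
by rewrite -scalemxAl -scalemxAr scalerA.
Qed.

Lemma is_derive_expmx M i j t : is_derive t (1 : R)
  (fun s : R => expmx (s *: M) i j) (\sum_l M i l * expmx (t *: M) l j).
Proof.
have s0 : 0 <= entry_sum M by rewrite !sumr_ge0// => ? _; rewrite sumr_ge0.
have cM l e s : cvgn (pseries (fun k => (M ^+ (k + e)) l j / k`!%:R) s).
  apply: (@cvg_exp_pseries _ (entry_sum M ^+ e) (entry_sum M)) => // k.
  by rewrite -exprD addnC expr_mx_entry_le.
have cM0 l s : cvgn (pseries (fun k => (M ^+ k) l j / k`!%:R) s).
  by have := cM l 0%N s; under eq_fun do rewrite addn0.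
have -> : (fun s : R => expmx (s *: M) i j) =
    (fun s => limn (pseries (fun k => (M ^+ k) i j / k`!%:R) s)).
  by apply/funext => s; exact: expmx_scale.
apply: is_derive_eq.
  apply: (@pseries_snd_diffs _ _ (`|t| + 1)); last first.
    by rewrite (ger0_norm (addr_ge0 _ _))// ltrDl.
  - rewrite !pseries_diffs_fact; have := cM i 2%N (`|t| + 1).
    by under eq_fun do rewrite addn2.
  - rewrite !pseries_diffs_fact; have := cM i 1%N (`|t| + 1).
    by under eq_fun do rewrite addn1.
  - exact: cM0.
rewrite pseries_diffs_fact; apply: cvg_lim => //.
have -> : pseries (fun k => (M ^+ k.+1) i j / k`!%:R) t =
    (fun N => \sum_l M i l * pseries (fun k => (M ^+ k) l j / k`!%:R) t N).
  apply/funext => N; rewrite /pseries /series/=.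
  under [RHS]eq_bigr do rewrite mulr_sumr.
  rewrite exchange_big/=; apply: eq_bigr => k _.
  rewrite (_ : M ^+ k.+1 = M *m M ^+ k); last by rewrite exprS.
rewrite mxE !mulr_suml.
  by apply: eq_bigr => l _; rewrite !mulrA.
apply: (@cvg_big R^o) => [|l _]; first exact: add_continuous.
by rewrite expmx_scale; apply: cvgM; [exact: cvg_cst|exact: cM0].
Qed.

Lemma expmx0 : expmx (0 : 'M[R]_n) = 1%:M.
Proof.
apply/matrixP => i j; rewrite -(scale0r (1%:M : 'M[R]_n)) expmx_scale.
apply: cvg_lim => //; rewrite -(cvg_shiftn 1).
rewrite [X in X @ _](_ : _ = fun=> (1%:M : 'M[R]_n) i j); first exact: cvg_cst.
apply/funext => N; rewrite /pseries/series/= addn1 big_nat_recl//= big1.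
  by rewrite fact0 divr1 expr0 mulr1 addr0.
by move=> k _; rewrite expr0n mulr0.
Qed.

End MatrixExponential.

(** * Exponential stages with deadlines *)

Section ExponentialStage.
Context {R : realType}.
Local Notation mu := (@lebesgue_measure R).
Variable rate : R.

(** Success after the deadline d has probability 0. *)
Definition killed_after (d : R) (f : R -> R) (y : R) : R :=
  if y <= d then f y else 0.

(** The probability of success at time s when an Exp(rate) stage has to end
    before the deadline d and success has probability f(t) if it ends at t. *)
Definition exp_stage (d : R) (f : R -> R) (s : R) : R :=
  fine (\int[mu]_r (exponential_pdf rate r * killed_after d f (s + r))%:E).

Record unit_decreasing (f : R -> R) : Prop := {
  unit_decreasing_continuous : continuous f;
  unit_decreasing_homo : forall s t, s <= t -> f t <= f s;
  unit_decreasing_ge0 : forall s, 0 <= f s;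
  unit_decreasing_le1 : forall s, f s <= 1
}.

Hypothesis rate_gt0 : 0 < rate.

Lemma measurable_killed_after d f : measurable_fun setT f ->
  measurable_fun setT (killed_after d f).
Proof.
move=> mf; apply: measurable_fun_ifT => //.
exact: measurable_fun_ler.
Qed.

Section OneStage.
Variables (d : R) (f : R -> R).
Hypothesis fU : unit_decreasing f.
Let f_cont := unit_decreasing_continuous fU.
Let f_mono := unit_decreasing_homo fU.
Let f_ge0 := unit_decreasing_ge0 fU.
Let f_le1 := unit_decreasing_le1 fU.

Let mf : measurable_fun [set: R] f.
Proof. exact: continuous_measurable_fun. Qed.

Lemma killed_after_ge0 y : 0 <= killed_after d f y.
Proof. by rewrite /killed_after; case: ifP. Qed.

Lemma killed_after_le1 y : killed_after d f y <= 1.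
Proof. by rewrite /killed_after; case: ifP. Qed.

Lemma killed_after_homo s t : s <= t ->
  killed_after d f t <= killed_after d f s.
Proof.
move=> st; rewrite /killed_after; case: ifP => td.
  by rewrite (le_trans st td) f_mono.
by case: ifP.
Qed.

Let integrand s r : R := exponential_pdf rate r * killed_after d f (s + r).

Lemma measurable_exp_stage_integrand s :
  measurable_fun setT (fun r => (integrand s r)%:E).
Proof.
apply/measurable_EFinP; apply: measurable_funM.
  exact: measurable_exponential_pdf.
apply: measurableT_comp; first exact: measurable_killed_after.
exact: measurable_funD.
Qed.

Let integrand_ge0 s r : 0 <= integrand s r.
Proof. by rewrite mulr_ge0 ?killed_after_ge0// exponential_pdf_ge0// ltW. Qed.

Let integral_bounds s :
  (0 <= \int[mu]_r (integrand s r)%:E <= 1)%E.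
Proof.
apply/andP; split; first by apply: integral_ge0 => r _; rewrite lee_fin.
rewrite -(integral_exponential_pdf rate_gt0); apply: ge0_le_integral => //.
- by move=> r _; rewrite lee_fin.
- exact: measurable_exp_stage_integrand.
- by apply/measurable_EFinP; exact: measurable_exponential_pdf.
- move=> r _; rewrite lee_fin ler_piMr ?killed_after_le1//.
  by rewrite exponential_pdf_ge0// ltW.
Qed.

Lemma exp_stageE s :
  (\int[mu]_r (exponential_pdf rate r * killed_after d f (s + r))%:E)%E =
  (exp_stage d f s)%:E.
Proof.
rewrite /exp_stage fineK//; have /andP[h0 h1] := integral_bounds s.
by rewrite ge0_fin_numE// (le_lt_trans h1)// ltry.
Qed.

Lemma exp_stage_ge0 s : 0 <= exp_stage d f s.
Proof. by rewrite -lee_fin -exp_stageE; case/andP: (integral_bounds s). Qed.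

Lemma exp_stage_le1 s : exp_stage d f s <= 1.
Proof. by rewrite -lee_fin -exp_stageE; case/andP: (integral_bounds s). Qed.

Lemma exp_stage_homo s t : s <= t -> exp_stage d f t <= exp_stage d f s.
Proof.
move=> st; rewrite -lee_fin -!exp_stageE; apply: ge0_le_integral => //.
- by move=> r _; rewrite lee_fin; exact: integrand_ge0.
- exact: measurable_exp_stage_integrand.
- exact: measurable_exp_stage_integrand.
- move=> r _; rewrite lee_fin ler_wpM2l ?killed_after_homo ?lerD2r//.
  by rewrite exponential_pdf_ge0// ltW.
Qed.

Lemma exp_stage_le s : exp_stage d f s <= f s.
Proof.
have fE : ((f s)%:E = \int[mu]_r ((f s)%:E * (exponential_pdf rate r)%:E))%E.
  rewrite ge0_integralZl//; last 3 first.
  - by apply/measurable_EFinP; exact: measurable_exponential_pdf.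
  - by move=> r _; rewrite lee_fin exponential_pdf_ge0// ltW.
  - by rewrite lee_fin.
  by rewrite integral_exponential_pdf// mule1.
rewrite -lee_fin -exp_stageE fE.
apply: ge0_le_integral => //.
- by move=> r _; rewrite lee_fin; exact: integrand_ge0.
- exact: measurable_exp_stage_integrand.
- apply/measurable_EFinP; apply: measurable_funM => //.
  exact: measurable_exponential_pdf.
- move=> r _; rewrite lee_fin mulrC.
  have [r0|r0] := ltP r 0; first by rewrite lt0_exponential_pdf// !mulr0.
  rewrite ler_wpM2r ?exponential_pdf_ge0 ?(ltW rate_gt0)// /killed_after.
  by case: ifP => // _; rewrite f_mono// lerDl.
Qed.

Lemma exp_stage_itv s : (exp_stage d f s)%:E =
  (\int[mu]_(r in `[0%R, (d - s)%R]) (rate * expR (- rate * r) * f (s + r))%:E)%E.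
Proof.
rewrite -exp_stageE [RHS]integral_mkcond; apply: eq_integral => r _.
rewrite patchE mem_setE in_itv/= lerBrDl /killed_after.
have [r0|r0] /= := leP 0 r; last by rewrite lt0_exponential_pdf// mul0r.
by case: ifP => _; rewrite ?mulr0// exponential_pdfE.
Qed.

Lemma exp_stage_late s : d <= s -> exp_stage d f s = 0.
Proof.
move=> ds; apply: EFin_inj; rewrite exp_stage_itv.
apply: (integral_Sset1 0) => r /=; rewrite in_itv/= => /andP[r0 rd].
by apply/eqP; rewrite eq_le r0 andbT (le_trans rd)// subr_le0.
Qed.

(** The integral over the remaining time becomes explicit once a primitive G of
    the discounted density is known; this is what makes [exp_stage] smooth
    before the deadline. *)
Lemma exp_stage_primitive (c s : R) (G : R -> R) : c < s -> s < d ->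
  (forall y, c < y -> is_derive y 1 G (rate * expR (- rate * y) * f y)) ->
  exp_stage d f s = expR (rate * s) * (G d - G s).
Proof.
move=> cs sd GE; apply: EFin_inj; rewrite exp_stage_itv.
have HE r : c - s < r -> is_derive r 1 (fun r => expR (rate * s) * G (s + r))
    (rate * expR (- rate * r) * f (s + r)).
  rewrite ltrBlDl => /GE.
  have -> : rate * expR (- rate * r) * f (s + r) =
      expR (rate * s) * (rate * expR (- rate * (s + r)) * f (s + r)).
    by rewrite mulrA; congr (_ * _); rewrite mulrCA -expRD; congr (_ * expR _); ring.
  move=> GE'; apply: is_deriveZ.
  have Hs : is_derive r 1 (fun r => s + r) 1.
    by apply: is_derive_eq; rewrite add0r mulr1.
  by have := is_derive1_comp GE' Hs; rewrite mulr1.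
have Hc r : c - s < r -> {for r, continuous (fun r => expR (rate * s) * G (s + r))}.
  by move=> /HE/is_derive_continuous.
have hc : continuous (fun r : R => rate * expR (- rate * r) * f (s + r)).
  move=> r; apply: (@continuousM R R (fun r => rate * expR (- rate * r)) (fun r => f (s + r))).

    by apply: is_derive_continuous; exact: is_derive_eq.
  apply: (@continuous_comp _ _ _ (fun r : R => s + r)); last exact: f_cont.
  by apply: is_derive_continuous; exact: is_derive_eq.
rewrite (@continuous_FTC2 _ _ (fun r => expR (rate * s) * G (s + r))); first last.
- move=> r; rewrite in_itv/= => /andP[r0 _].
  by rewrite derive1E; apply: derive_val; apply: HE; lra.
- split.
  + move=> r; rewrite in_itv/= => /andP[r0 _].
    by have [] := HE r (_ : c - s < r); first lra.
  + by apply: cvg_at_right_filter; apply: Hc; lra.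
  + by apply: cvg_at_left_filter; apply: Hc; lra.
- exact: continuous_subspaceT.
- by rewrite subr_gt0.
by rewrite -EFinB subrKC addr0 -mulrBr.
Qed.
Let continuous_density : continuous (fun y : R => rate * expR (- rate * y) * f y).
Proof.
move=> y; apply: (@continuousM R R (fun y => rate * expR (- rate * y)) f);
  last exact: f_cont.
by apply: is_derive_continuous; exact: is_derive_eq.
Qed.

(** Backward equation of one stage. *)
Lemma is_derive_exp_stage s : s < d ->
  is_derive s 1 (exp_stage d f) (rate * (exp_stage d f s - f s)).
Proof.
move=> sd; have [G GE] := exists_primitive (s - 1) continuous_density.
have ss : s - 1 < s by rewrite ltrBlDr ltrDl.
apply: (near_eq_is_derive (f := fun t => expR (rate * t) * (G d - G t))).
  near=> t; apply/esym/(exp_stage_primitive _ _ GE).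
    by near: t; exact: lt_nbhsr.
  by near: t; exact: lt_nbhsl.
rewrite (exp_stage_primitive ss sd GE); have dG := GE s ss.
apply: is_derive_eq; rewrite /GRing.scale/= !mulr1.
have : expR (rate * s) * expR (- rate * s) = 1.
  by rewrite -expRD mulNr subrr expR0.
move=> E; transitivity (rate * (expR (rate * s) * (G d - G s)) -
  rate * f s * (expR (rate * s) * expR (- rate * s))); first by ring.
by rewrite E; ring.
Unshelve. all: by end_near. Qed.

(** At the deadline the two regimes agree: both sides are the formula of
    [exp_stage_primitive] at time min(s, d). *)
Lemma exp_stage_continuous : continuous (exp_stage d f).
Proof.
move=> s; pose c := Num.min s d - 1.
have [cs cd] : c < s /\ c < d.
  by split; rewrite /c ltrBlDr; [apply: (@le_lt_trans _ _ s)|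
    apply: (@le_lt_trans _ _ d)]; rewrite ?ge_min ?lexx ?orbT// ltrDl.
have [G GE] := exists_primitive c continuous_density.
pose g t := expR (rate * t) * (G d - G t).
have gc t : c < t -> {for t, continuous g}.
  move=> /GE dG; apply: is_derive_continuous; exact: is_derive_eq.
suff gs : {for s, continuous (fun t => g (Num.min t d))}.
  have E t : c < t -> exp_stage d f t = g (Num.min t d).
    move=> ct; have [td|dt] := ltP t d; first exact: exp_stage_primitive GE.
    by rewrite exp_stage_late// /g subrr mulr0.
  rewrite /prop_for /continuous_at E//; apply: cvg_trans gs.
  apply: near_eq_cvg; near=> t; apply/esym/E.
  by near: t; exact: lt_nbhsr.
apply: (@continuous_comp _ _ _ (fun t => Num.min t d) g).
  apply: (@continuous_min R R id (cst d)); first exact: cvg_id.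
  exact: cst_continuous.
by apply: gc; rewrite lt_min cs.
Unshelve. all: by end_near. Qed.

Lemma exp_stage_unit_decreasing : unit_decreasing (exp_stage d f).
Proof.
split; [exact: exp_stage_continuous|exact: exp_stage_homo|
  exact: exp_stage_ge0|exact: exp_stage_le1].
Qed.
End OneStage.

Lemma unit_decreasing_cst1 : unit_decreasing (fun=> 1).
Proof. by split => // s; exact: cst_continuous. Qed.

(** The probability of success at a given time when n claims remain, each made
    of p stages, the first of them due at a 0, the next one at a 1, and so on. *)
Fixpoint block_stages (p n : nat) (a : nat -> R) : R -> R :=
  if n is n'.+1
  then iter p (exp_stage (a 0%N)) (block_stages p n' (fun k => a k.+1))
  else fun=> 1.

Lemma iter_exp_stage_unit_decreasing d f j : unit_decreasing f ->
  unit_decreasing (iter j (exp_stage d) f).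
Proof. by move=> fU; elim: j => //= j IH; exact: exp_stage_unit_decreasing. Qed.

Lemma block_stages_unit_decreasing p n a : unit_decreasing (block_stages p n a).
Proof.
elim: n a => [|n IH] a /=; first exact: unit_decreasing_cst1.
exact: iter_exp_stage_unit_decreasing.
Qed.

Lemma iter_exp_stage_le d f i j s : unit_decreasing f -> (i <= j)%N ->
  iter j (exp_stage d) f s <= iter i (exp_stage d) f s.
Proof.
move=> fU /subnK <-; elim: (j - i)%N => // k; apply: le_trans.
rewrite addSn iterS; apply: exp_stage_le.
exact: iter_exp_stage_unit_decreasing.
Qed.

End ExponentialStage.

(** * Independence and conditioning *)

Section Independence.
Context {d : measure_display} {T : measurableType d} {R : realType}.
Variable P : probability T R.

(** The sample space with the sigma-algebra of a subfamily: a function measurable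
    on this type depends on that subfamily only. *)
Definition process_sigma_type (I : Type) (J : set I) (d' : measure_display)
    (T' : measurableType d') (X : I -> T -> T') :=
  g_sigma_algebraType
    (\bigcup_(i in J) preimage_set_system setT (X i) measurable).

Lemma process_sigma_algebra_measurable (I : Type) (J : set I) d'
    (T' : measurableType d') (X : I -> T -> T') :
  (forall i, J i -> measurable_fun setT (X i)) ->
  process_sigma_algebra J X `<=` measurable.
Proof.
move=> mX; apply: smallest_sub; first exact: sigma_algebra_measurable.
by move=> _ [i Ji [B mB <-]]; exact: (mX i Ji).
Qed.

Lemma process_sigma_type_measurable (I : Type) (J : set I) d'
    (T' : measurableType d') (X : I -> T -> T') i : J i ->
  measurable_fun [set: process_sigma_type J X] (X i).
Proof.
by move=> Ji _ B mB; apply: sub_sigma_algebra; exists i => //; exists B.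
Qed.

(** The rectangles built on J form a pi-system on which the product rule is the
    definition of independence, and the events satisfying the rule form a Dynkin
    system. *)
Lemma mutually_independent_new (I : choiceType) (J : set I) d'
    (T' : measurableType d') (X : I -> T -> T') (i : I) (A : set T') (E : set T) :
  (forall i, measurable_fun setT (X i)) ->
  mutually_independent P X -> ~ J i -> measurable A ->
  process_sigma_algebra J X E ->
  P (X i @^-1` A `&` E) = (P (X i @^-1` A) * P E)%E.
Proof.
move=> mX indX nJi mA; set U := X i @^-1` A.
have mU : measurable U by rewrite -[U]setTI; exact: mX.
pose G : set (set T) := [set E | exists (s : seq I) (B : I -> set T'),
  [/\ uniq s, (forall j, j \in s -> J j), (forall j, measurable (B j)) &
   E = \bigcap_(j in [set` s]) (X j @^-1` B j)]].
pose H : set (set T) := [set E | measurable E /\ P (U `&` E) = (P U * P E)%E].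
suff sGH : <<s G >> `<=` H.
  move=> PE; suff /sGH[] : <<s G >> E by [].
  apply: smallest_sub PE; first exact: smallest_sigma_algebra.
  move=> _ [j Jj [B mB <-]]; apply: sub_sigma_algebra.
  exists [:: j], (fun=> B); split => //; first by move=> k /[!inE] /eqP ->.
  by rewrite bigcap_seq big_seq1 setTI.
apply: lambda_system_subset => //.
- move=> _ _ [s [B [us sJ mB ->]]] [s' [B' [us' s'J mB' ->]]].
  exists (undup (s ++ s')), (fun j => (if j \in s then B j else setT) `&`
    (if j \in s' then B' j else setT)); split.
  + exact: undup_uniq.
  + by move=> j; rewrite mem_undup mem_cat => /orP[/sJ|/s'J].
  + by move=> j; apply: measurableI; case: ifP.
  + apply/seteqP; split=> w.
      move=> [h h'] j _; split; case: ifP => // js; [exact: h|exact: h'].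
    move=> h; split => j /= js.
      by have := h j; rewrite /= mem_undup mem_cat js => /(_ isT)[].
    by have := h j; rewrite /= mem_undup mem_cat js orbT => /(_ isT)[].
- apply/dynkin_lambda_system; split.
  + by split => //; rewrite setIT probability_setT mule1.
  + move=> E' [mE' PE']; split; first exact: measurableC.
    have -> : U `&` ~` E' = U `\` (U `&` E').
      by rewrite setDIr setDv set0U setDE.
    rewrite measureD//; last 2 first.
    * exact: measurableI.
    * by rewrite (le_lt_trans (probability_le1 _ mU))// ltry.
    transitivity (P U - P U * P E')%E.
      by congr (_ - _)%E; rewrite setIA setIid; exact: PE'.
    rewrite probability_setC//.
    have fU : P U \is a fin_num by exact: fin_num_measure.
    by rewrite muleBr// ?mule1// fin_num_adde_defl// fin_numN fin_num_measure.
  + move=> F tF HF; have mF k : measurable (F k) by have [] := HF k.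
    split; first exact: bigcupT_measurable.
    rewrite setI_bigcupr measure_semi_bigcup//; last 3 first.
    * by move=> k; exact: measurableI.
    * exact: trivIset_setIl.
    * by apply: bigcupT_measurable => k; exact: measurableI.
    rewrite measure_semi_bigcup//; last exact: bigcupT_measurable.
    have fU : P U \is a fin_num by exact: fin_num_measure.
    rewrite -(fineK fU) -nneseriesZl//.
    by apply: eq_eseriesr => k _; rewrite fineK//; have [] := HF k.
- move=> _ [s [B [us sJ mB ->]]].
  have mXB j : measurable (X j @^-1` B j) by rewrite -[_ @^-1` _]setTI; exact: mX.
  split.
    by rewrite bigcap_seq; apply: bigsetI_measurable => j _.
  pose C j := if j == i then A else B j.
  have si j : j \in s -> j != i by move=> js; apply/eqP => ji; apply/nJi/sJ; rewrite -ji.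
  have sC j : j \in s -> C j = B j by move=> /si /negbTE; rewrite /C => ->.
  have Ci : C i = A by rewrite /C eqxx.
  have uis : uniq (i :: s) by rewrite /= us andbT; apply/negP => /sJ.
  have mC j : measurable (C j) by rewrite /C; case: ifP.
  have := indX _ C uis mC; rewrite !big_cons Ci.
  rewrite (eq_big_seq (fun j => X j @^-1` B j)); last by move=> j /sC ->.
  rewrite [X in (_ * X)%E](eq_big_seq (fun j => P (X j @^-1` B j))); last first.
    by move=> j /sC ->.
  by rewrite -indX// bigcap_seq.
Qed.

(** The joint law is the product of the marginal ones, so this is Fubini. *)
Lemma integral_independent_pair d' (T' : measurableType d')
    (X : {RV P >-> R}) (Z : {RV P >-> T'}) (h : R * T' -> \bar R) :
  (forall A B, measurable A -> measurable B ->
    P (X @^-1` A `&` Z @^-1` B) = (P (X @^-1` A) * P (Z @^-1` B))%E) ->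
  measurable_fun setT h -> (forall z, 0 <= h z)%E ->
  (\int[P]_w h (X w, Z w) =
   \int[distribution P X]_x \int[P]_w h (x, Z w))%E.
Proof.
move=> indXZ mh h0.
have mW : measurable_fun setT (fun w => (X w, Z w)).
  by apply: measurable_fun_pair; exact: measurable_funP.
pose W : {RV P >-> (R * T')%type} :=
  HB.pack (fun w => (X w, Z w)) (isMeasurableFun.Build _ _ _ _ _ mW).
transitivity (\int[distribution P W]_z h z)%E.
  by rewrite ge0_integral_distribution.
transitivity (\int[distribution P X \x distribution P Z]_z h z)%E.
  apply: eq_measure_integral => A mA _; apply/esym.
  by apply: product_measure_unique => // A1 A2 mA1 mA2; exact: indXZ.
rewrite fubini_tonelli1//; apply: eq_integral => x _; rewrite /fubini_F.
rewrite ge0_integral_distribution//.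
exact: measurableT_comp mh (measurable_pair1 _).
Qed.

(** The law is known through its density on measurable sets only; uniqueness of
    the Radon-Nikodym derivative turns this into a formula for integrals. *)
Lemma integral_exponential (rate : R) (X : {RV P >-> R}) (h : R -> R) :
  0 < rate -> exponential_rv rate X -> measurable_fun setT h ->
  (forall x, 0 <= h x <= 1) ->
  (\int[distribution P X]_x (h x)%:E =
   \int[lebesgue_measure]_r (exponential_pdf rate r * h r)%:E)%E.
Proof.
move=> rate0 Xexp mh h01.
have mpdf := measurable_exponential_pdf rate.
have pdf0 r : 0 <= exponential_pdf rate r by rewrite exponential_pdf_ge0// ltW.
(* Lebesgue measure lives on the type [measurableTypeR R], which has the same
   measurable sets as [R]; the law of X is moved there. *)
have mX : measurable_fun setT (X : T -> measurableTypeR R).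
  exact: (measurable_funP X).
pose X' : {RV P >-> measurableTypeR R} :=
  HB.pack (X : T -> measurableTypeR R) (isMeasurableFun.Build _ _ _ _ _ mX).
pose nu : probability (measurableTypeR R) R := distribution P X'.
have nuE (B : set R) : measurable B ->
    nu B = (\int[lebesgue_measure]_(x in B) (exponential_pdf rate x)%:E)%E.
  exact: Xexp.
transitivity (\int[nu]_x (h x)%:E)%E.
  rewrite ge0_integral_distribution; last 2 first.
  - exact/measurable_EFinP.
  - by move=> x; have /andP[] := h01 x; rewrite lee_fin.
  rewrite /nu ge0_integral_distribution//; first exact/measurable_EFinP.
  by move=> x; have /andP[] := h01 x; rewrite lee_fin.
have dom : nu `<< @lebesgue_measure R.
  apply/null_content_dominatesP => B mB B0; rewrite nuE//.
  apply: null_set_integral => //.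
  by apply/measurable_EFinP; exact: measurable_funTS.
have mhE : measurable_fun setT (EFin \o h) by exact/measurable_EFinP.
rewrite -(Radon_Nikodym_change_of_variables dom)//; last first.
  apply: (@le_integrable _ _ _ _ _ _ _ (cst 1%E)) => //.
  - move=> x _ /=; have /andP[h0 h1] := h01 x.
    by rewrite lee_fin (ger0_norm h0) normr1.
  - exact: finite_measure_integrable_cst.
under [RHS]eq_integral do rewrite mulrC EFinM.
have RNi := Radon_Nikodym_integrable (nu := charge_of_finite_measure nu) dom.
apply: ae_eq_integral => //.
- by apply: emeasurable_funM => //; exact: measurable_int RNi.
- by apply: emeasurable_funM => //; exact/measurable_EFinP.
apply: ae_eqe_mul2l; rewrite (Radon_NikodymE (nu := charge_of_finite_measure nu) dom).
case: cid => g [g1 g2 g3].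
apply: integral_ae_eq => //.
- exact/measurable_EFinP.
- by move=> B _ mB; rewrite -g3//= nuE.
Qed.

End Independence.

(** * Independent claims made of exponential stages *)

Section StageLaw.
Context {R : realType}.

(** X behaves as a succession of p stages of rate [rate], in the only way that
    matters when it is followed by a random continuation: success probabilities
    are averaged over x + X as over the end of p stages.  Exponential and Erlang
    variables are both covered. *)
Definition stage_law (p : nat) (rate : R) d (T : measurableType d)
    (P : probability T R) (X : {RV P >-> R}) : Prop :=
  forall (f : R -> R) (e x : R), unit_decreasing f ->
  (\int[distribution P X]_r (killed_after e f (x + r))%:E =
   (killed_after e (iter p (exp_stage rate e) f) x)%:E)%E.

Context {d : measure_display} {T : measurableType d} (P : probability T R).

Lemma killed_exp_stage (rate e : R) (f : R -> R) : 0 < rate -> unit_decreasing f ->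
  killed_after e (exp_stage rate e f) = exp_stage rate e f.
Proof.
move=> rate0 fU; apply/funext => x; rewrite /killed_after.
by have [//|/ltW ex] := leP x e; rewrite exp_stage_late.
Qed.

Lemma measurable_killed_shift (e x : R) (f : R -> R) d' (T' : measurableType d')
    (g : T' -> R) : unit_decreasing f -> measurable_fun setT g ->
  measurable_fun setT (fun w => (killed_after e f (x + g w))%:E).
Proof.
move=> fU mg; apply/measurable_EFinP; apply: measurableT_comp.
  apply: measurable_killed_after; apply: continuous_measurable_fun.
  exact: unit_decreasing_continuous.
exact: measurable_funD.
Qed.

Lemma exponential_stage_law (rate : R) (X : {RV P >-> R}) :
  0 < rate -> exponential_rv rate X -> stage_law 1 rate X.
Proof.
move=> rate0 Xexp f e x fU; rewrite /= killed_exp_stage// -exp_stageE//.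
apply: integral_exponential => //.
  by apply/measurable_EFinP; exact: measurable_killed_shift.
by move=> r; rewrite killed_after_ge0// killed_after_le1.
Qed.

Section Peel.
Variables (I : choiceType) (X : I -> {RV P >-> R}).
Hypothesis X_indep : mutually_independent P (fun i => X i : T -> R).

Lemma measurable_process_snd (J : set I) (j : I) : J j ->
  measurable_fun [set: R * process_sigma_type J (fun i => X i : T -> R)]
    (fun z => X j z.2).
Proof.
move=> Jj.
have mXj : measurable_fun
    [set: process_sigma_type J (fun i => X i : T -> R)] (X j).
  exact: (process_sigma_type_measurable (X := fun i => X i : T -> R) Jj).
have := @measurableT_comp _ _ _
  (R * process_sigma_type J (fun i => X i : T -> R))%type _ _ _ setT snd
  mXj (@measurable_snd _ _ _ _).
exact.
Qed.

(** Conditioning on X_i when the rest of the integrand depends on the X_j with j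
    in J: the second component of the pair is the sample point itself, seen
    through the sigma-algebra of the X_j. *)
Lemma integral_peel (J : set I) (i : I)
    (h : R * process_sigma_type J (fun i => X i : T -> R) -> \bar R) :
  ~ J i -> measurable_fun setT h -> (forall z, 0 <= h z)%E ->
  (\int[P]_w h (X i w, w) = \int[distribution P (X i)]_x \int[P]_w h (x, w))%E.
Proof.
move=> nJi mh h0.
have mid : measurable_fun setT
    (fun w : T => w : process_sigma_type J (fun i => X i : T -> R)).
  move=> _ B mB; rewrite setTI.
  by apply: process_sigma_algebra_measurable mB => j _.
pose Z : {RV P >-> process_sigma_type J (fun i => X i : T -> R)} :=
  HB.pack (fun w : T => w : process_sigma_type J (fun i => X i : T -> R))
    (isMeasurableFun.Build _ _ _ _ _ mid).
apply: (@integral_independent_pair _ _ _ P _ _ (X i) Z h) => // A B mA mB.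
apply: (mutually_independent_new (X := fun i => X i : T -> R)) mB => //.
Qed.

Lemma integral_killed_sum (rate e : R) (f : R -> R) (s : seq I) (x : R) :
  0 < rate -> (forall i, exponential_rv rate (X i)) -> uniq s ->
  unit_decreasing f ->
  (\int[P]_w (killed_after e f (x + \sum_(j <- s) X j w))%:E =
   (killed_after e (iter (size s) (exp_stage rate e) f) x)%:E)%E.
Proof.
move=> rate0 Xexp + fU; elim: s x => [|i s IH] x.
  move=> _; under eq_integral do rewrite big_nil addr0.
  by rewrite integral_cst//= probability_setT mule1.
move=> /= /andP[si us].
pose h (z : R * process_sigma_type [set` s] (fun i => X i : T -> R)) :=
  (killed_after e f (x + (z.1 + \sum_(j <- s) X j z.2)))%:E.
transitivity (\int[P]_w h (X i w, w))%E.
  by apply: eq_integral => w _; rewrite big_cons.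
rewrite integral_peel; last 3 first.
- by move=> /= iins; rewrite iins in si.
- apply: measurable_killed_shift => //; apply: measurable_funD => //.
  rewrite (_ : (fun z => _) = (fun z : R * process_sigma_type [set` s] _ =>
      \sum_(j <- s) (if j \in s then X j z.2 else 0))); last first.
    by apply/funext => z; rewrite [LHS]big_seq [LHS]big_mkcond.
  apply: measurable_sum => j; case: (boolP (j \in s)) => // js.
  exact: measurable_process_snd.
- by move=> z; rewrite lee_fin killed_after_ge0.
transitivity (\int[distribution P (X i)]_r
    (killed_after e (iter (size s) (exp_stage rate e) f) (x + r))%:E)%E.
  apply: eq_integral => r _; rewrite -IH//.
  by apply: eq_integral => w _; rewrite /h/= addrA.
apply: exponential_stage_law => //.
exact: iter_exp_stage_unit_decreasing.
Qed.

End Peel.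

End StageLaw.

Section Deadlines.
Context {R : realType} {d : measure_display} {T : measurableType d}.
Variable P : probability T R.

Lemma erlang_stage_law (p : nat) (rate : R) (X : {RV P >-> R}) :
  0 < rate -> erlang_rv p rate X -> stage_law p rate X.
Proof.
move=> rate0 [d' [T' [P' [E [Eind Eexp XE]]]]] f e x fU.
have mS : measurable_fun setT (fun w => \sum_(j < p) E j w).
  by apply: measurable_sum.
pose S : {RV P' >-> R} := HB.pack (fun w => \sum_(j < p) E j w)
    (isMeasurableFun.Build _ _ _ _ _ mS).
rewrite (eq_measure_integral (distribution P' S)); last by move=> B mB _; exact: XE.
rewrite ge0_integral_distribution; last 2 first.
- exact: measurable_killed_shift.
- by move=> y; rewrite lee_fin killed_after_ge0.
have := integral_killed_sum Eind e x rate0 Eexp (enum_uniq 'I_p) fU.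
rewrite size_enum_ord => <-; apply: eq_integral => w _.
by rewrite /= big_enum.
Qed.

(** Conditioning on the first claim: its end x + r must respect the first
    deadline, and the remaining claims then start from x + r. *)
Lemma deadlines_block_stages (p : nat) (rate : R) (X : nat -> {RV P >-> R})
    (k n : nat) (a : nat -> R) (x : R) :
  0 < rate -> (0 < p)%N -> mutually_independent P (fun i => X i : T -> R) ->
  (forall i, stage_law p rate (X i)) ->
  P [set w | forall l, (l < n)%N -> x + \sum_(k <= j < k + l.+1) X j w <= a l] =
    (block_stages rate p n a x)%:E.
Proof.
move=> rate0 p0 Xind Xlaw; elim: n k a x => [|n IH] k a x.
  by rewrite [X in P X](_ : _ = setT) ?probability_setT//; apply/seteqP.
pose J := [set j : nat | (k < j)%N].
pose V (z : R * process_sigma_type J (fun i => X i : T -> R)) : Prop :=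
  (x + z.1 <= a 0%N)%R /\ forall l, (l < n)%N ->
    x + z.1 + \sum_(k.+1 <= j < k.+1 + l.+1) X j z.2 <= a l.+1.
have mV : measurable [set z | V z].
  apply: measurableI.
    by apply: measurable_le_set; apply: measurable_funD.
  apply: measurable_forall_lt => l ln.
  apply: measurable_le_set; apply: measurable_funD.
    exact: measurable_funD.
  rewrite (_ : (fun z => _) = (fun z : R * process_sigma_type J _ =>
      \sum_(k.+1 <= j < k.+1 + l.+1) (if (k < j)%N then X j z.2 else 0))).
    apply: measurable_sum => j; case: (boolP (k < j)%N) => // kj.
    exact: measurable_process_snd.
  apply/funext => z; apply: eq_big_nat => j /andP[kj _].
  by rewrite kj.
pose h z := (\1_[set z | V z] z : R)%:E.
have VE w : V (X k w, w) <->
    (forall l, (l < n.+1)%N -> x + \sum_(k <= j < k + l.+1) X j w <= a l).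
  have sumE l : \sum_(k <= j < k + l.+1) X j w =
      X k w + \sum_(k.+1 <= j < k + l.+1) X j w.
    by rewrite big_ltn// addnS ltnS leq_addr.
  split=> [[h0 hS] [_|l ln]|hw].
  - by rewrite addn1 big_nat1.
  - by rewrite sumE addrA; have := hS l ln; rewrite addSnnS.
  - split; first by have := hw 0%N isT; rewrite addn1 big_nat1.
    by move=> l ln; have := hw l.+1 ln; rewrite sumE addrA addSnnS.
have mEv k' n' (a' : nat -> R) y : measurable
    [set w | forall l, (l < n')%N ->
      y + \sum_(k' <= j < k' + l.+1) X j w <= a' l].
  apply: measurable_forall_lt => l ln; apply: measurable_le_set.
  by apply: measurable_funD => //; exact: measurable_sum.
transitivity (\int[P]_w h (X k w, w))%E.
  rewrite -[X in P X]setIT -integral_indic//.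
  apply: eq_integral => w _; congr (_%:E); apply: eq_indic.
  by have := VE w; tauto.
rewrite integral_peel//; last 3 first.
- by rewrite /J/= ltnn.
- by apply/measurable_EFinP; exact: measurable_indic.
- by move=> z; rewrite lee_fin.
transitivity (\int[distribution P (X k)]_r
    (killed_after (a 0%N) (block_stages rate p n (fun l => a l.+1)) (x + r))%:E)%E.
  apply: eq_integral => r _; rewrite /killed_after; case: ifPn => xr.
    rewrite -(IH k.+1) -[X in P X]setIT -integral_indic//.
    apply: eq_integral => w _; congr (_%:E); apply: eq_indic.
    by split=> [[]|].
  rewrite integral0_eq// => w _; rewrite /h indicE memNset// => -[/= xr'].
  by rewrite xr' in xr.
rewrite Xlaw; last exact: block_stages_unit_decreasing.
clear -rate0 p0; case: p p0 => // p _ /=; rewrite killed_exp_stage//.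
exact/iter_exp_stage_unit_decreasing/block_stages_unit_decreasing.
Qed.

End Deadlines.

(** * Markov jump processes observed at deadlines *)

Section PhaseRates.
Context {R : realType}.
Variables (m : nat -> nat) (A : forall k, 'M[R]_(m k)).
Variables (D : forall k, 'M[R]_(m k, m k.+1)).
Variable n : nat.
Local Notation E := (phase_state m n).
Local Notation q := (@phase_rate R m A D n).

Definition phase_at (k : nat) (kn : (k < n)%N) (i : 'I_(m k)) : E :=
  Some (existT (fun k : 'I_n => 'I_(m k)) (Ordinal kn) i).

Definition block (x : E) : nat := if x is Some y then tag y : nat else n.

(** Functions on the phases of block k, for every k at once: beyond the last
    block the absorbing state takes the place of all phases, which spares a
    special case for k = n in the backward equations. *)
Definition on_block (f : E -> R) (k : nat) : 'I_(m k) -> R :=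
  match @idP (k < n)%N with
  | ReflectT kn => fun i => f (phase_at kn i)
  | ReflectF _ => fun=> f None
  end.

Lemma on_blockE f k (kn : (k < n)%N) i : on_block f i = f (phase_at kn i).
Proof.
rewrite /on_block; case: {-}_ / idP => // kn'.
by rewrite (bool_irrelevance kn' kn).
Qed.

Lemma on_block_ge f k (i : 'I_(m k)) : (n <= k)%N -> on_block f i = f None.
Proof.
by rewrite /on_block; case: {-}_ / idP => // kn; rewrite leqNgt kn.
Qed.

Lemma phase_stateP (x : E) :
  x = None \/ exists k (kn : (k < n)%N) i, x = phase_at kn i.
Proof.
case: x => [[[k kn] i]|]; last by left.
by right; exists k, kn, i.
Qed.

Lemma block_value_phase k (g : 'I_(m k) -> R) (kn : (k < n)%N) (i : 'I_(m k)) :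
  block_value g (existT (fun l : 'I_n => 'I_(m l)) (Ordinal kn) i) = g i.
Proof.
exact: (untagE 0 g (u := existT (fun l : nat => 'I_(m l)) k i) (erefl k)).
Qed.

Lemma block_value_other k (g : 'I_(m k) -> R) (y : {l : 'I_n & 'I_(m l)}) :
  (tag y : nat) != k -> block_value g y = 0.
Proof. by move=> yk; rewrite /block_value untag_dflt. Qed.

Lemma sum_block_value k (g : 'I_(m k) -> R) (f : E -> R) :
  \sum_y block_value g y * f (Some y) =
  if (k < n)%N then \sum_j g j * on_block f j else 0.
Proof.
case: ifPn => [kn|nk]; last first.
  apply: big1 => y _; rewrite block_value_other ?mul0r//.
  by apply: contraNneq nk => <-.
transitivity (\sum_(l < n) \sum_(j < m l)
    block_value g (existT (fun l : 'I_n => 'I_(m l)) l j) *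
    f (Some (existT (fun l : 'I_n => 'I_(m l)) l j))).
  rewrite (sig_big_dep _ (fun _ _ => true) (fun l j =>
    block_value g (existT (fun l : 'I_n => 'I_(m l)) l j) *
    f (Some (existT (fun l : 'I_n => 'I_(m l)) l j))))/=.
  by apply: eq_bigr => -[].
rewrite (bigD1 (Ordinal kn))//= [X in _ + X]big1 ?addr0; last first.
  move=> l lk; apply: big1 => j _; by rewrite block_value_other ?mul0r//.
apply: eq_bigr => j _.
by rewrite block_value_phase on_blockE.
Qed.

Lemma sum_phase_state (f : E -> R) :
  \sum_x f x = f None + \sum_y f (Some y).
Proof.
rewrite (bigD1 None)//=; congr (_ + _).
rewrite (reindex_omap Some id); last by case.
by apply: eq_bigl => y; rewrite eqxx.
Qed.

(** The generator acts blockwise; in the last block the rate D 1 into the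
    absorbing state is the sum over j in the second term. *)
Lemma sum_phase_rate k (kn : (k < n)%N) (i : 'I_(m k)) (f : E -> R) :
  \sum_y q (phase_at kn i) y * f y =
  \sum_j A k i j * on_block f j + \sum_j D k i j * on_block f j.
Proof.
rewrite sum_phase_state /=.
under eq_bigr do rewrite mulrDl.
rewrite big_split/= !sum_block_value kn addrCA; congr (_ + _).
case: eqP => [kn1|/eqP kn1].
  have -> : (k.+1 < n)%N = false by rewrite kn1 ltnn.
  rewrite addr0 mxE mulr_suml; apply: eq_bigr => j _.
  by rewrite mxE mulr1 on_block_ge// -kn1.
by rewrite mul0r add0r ltn_neqAle kn1 kn.
Qed.

End PhaseRates.

Section FiniteMarkov.
Context {R : realType} {E : finType}.
Variables (q : E -> E -> R) (a : nat -> R) (ok : nat -> pred E).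

Lemma is_derive_transition_probability x y t :
  is_derive t (1 : R) (fun s : R => transition_probability q s x y)
    (\sum_z q x z * transition_probability q t z y).
Proof.
apply: is_derive_eq; first exact: is_derive_expmx.
rewrite (reindex enum_rank) /=; last exact/onW_bij/enum_rank_bij.
by apply: eq_bigr => z _; rewrite mxE !enum_rankK.
Qed.

(** The probability, starting in x at time s, that the requirement [ok] holds at
    the r deadlines that follow, the next one being a l. *)
Fixpoint deadline_value (r l : nat) (s : R) (x : E) : R :=
  if r is r'.+1 then
    \sum_y transition_probability q (a l - s) x y *
      (if ok l y then deadline_value r' l.+1 (a l) y else 0)
  else 1.

Lemma is_derive_deadline_value r l s x :
  is_derive s (1 : R) (deadline_value r.+1 l ^~ x)
    (- \sum_z q x z * deadline_value r.+1 l s z).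
Proof.
pose g y := if ok l y then deadline_value r l.+1 (a l) y else 0.
have H y : is_derive s (1 : R)
    (fun s => transition_probability q (a l - s) x y * g y)
    (- (\sum_z q x z * transition_probability q (a l - s) z y) * g y).
  have H1 : is_derive s (1 : R) (fun s : R => a l - s) (-1).
    by apply: is_derive_eq; rewrite add0r mul1r.
  have H2 : is_derive s (1 : R)
      (fun s : R => transition_probability q (a l - s) x y)
      ((\sum_z q x z * transition_probability q (a l - s) z y) * -1).
    exact: (@is_derive1_comp _ (fun u => transition_probability q u x y)
      (fun s : R => a l - s) s _ _ (is_derive_transition_probability _ _ _) H1).
  have H3 : is_derive s (1 : R) (fun=> g y) 0 by exact: is_derive_cst.
  apply: (@is_derive_eq _ _ _ _ _ _ _ _ (is_deriveM H2 H3)).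
  by rewrite scaler0 add0r mulrN1 /GRing.scale/= mulrC.
have := is_derive_fin_sum H; rewrite /= -/g.
rewrite (_ : \sum_i _ = - \sum_z q x z * \sum_y
    transition_probability q (a l - s) z y * g y) //.
under [in RHS]eq_bigr do rewrite mulr_sumr.
rewrite exchange_big/= -sumrN; apply: eq_bigr => y _.
rewrite mulNr mulr_suml; congr (- _); apply: eq_bigr => z _.
by rewrite mulrA.
Qed.

Lemma deadline_value_at r l x :
  deadline_value r.+1 l (a l) x = if ok l x then deadline_value r l.+1 (a l) x else 0.
Proof.
rewrite /= (bigD1 x)//= big1 => [|y yx].
  by rewrite subrr /transition_probability scale0r expmx0 mxE eqxx mul1r addr0.
rewrite subrr /transition_probability scale0r expmx0 mxE.
by rewrite (can_eq enum_rankK) eq_sym (negbTE yx) mul0r.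
Qed.

Context {d : measure_display} {T : measurableType d}.
Variables (P : probability T R) (mu : E -> R) (phi : R -> T -> E).
Hypothesis phiP : markov_jump_process P mu q phi.

(** The finite-dimensional laws, summed over the admissible states at the last
    times one time after the other. *)
Lemma deadline_probability (n : nat) :
  (forall l, 0 <= a l) -> {homo a : i j / (i <= j)%N >-> i <= j} ->
  P [set w | forall l, (l < n)%N -> ok l (phi (a l) w)] =
    (\sum_x mu x * deadline_value n 0 0 x)%:E.
Proof.
move=> a0 amono.
pose t i := if i is i'.+1 then a i' else 0.
have tmono : {homo t : i j / (i <= j)%N >-> i <= j}.
  by move=> [|i] [|j] //= ij; exact: amono.
have t0 i : 0 <= t i by case: i => /=.
(* The path is prescribed up to time t k, and only required to be admissible at
   the r times that follow. *)
pose ev k r (x : nat -> E) := [set w | (forall i, (i <= k)%N -> phi (t i) w = x i) /\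
  (forall l, (k <= l < k + r)%N -> ok l (phi (a l) w))].
have mphi s x : 0 <= s -> measurable [set w | phi s w = x].
  exact: (mjp_measurable phiP).
have mok l : measurable [set w | ok l (phi (a l) w)].
  by apply: measurable_fibers => x; exact: mphi.
have mall k r : measurable
    [set w | forall l, (k <= l < k + r)%N -> ok l (phi (a l) w)].
  rewrite (_ : [set w | _] = [set w | forall l, (l < r)%N ->
      [set w | ok (k + l) (phi (a (k + l)%N) w)] w]).
    by apply: measurable_forall_lt => l _; exact: mok.
  apply/seteqP; split => w h l.
    by move=> lr; apply: h; rewrite leq_addr ltn_add2l.
  by move=> /andP[kl lk]; have := h (l - k)%N; rewrite /= subnKC//; apply;
    rewrite ltn_subLR.
have mev k r x : measurable (ev k r x).
  apply: measurableI; last exact: mall.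
  apply: (@measurable_forall_lt _ _ k.+1 (fun i => [set w | phi (t i) w = x i])).
  by move=> i _; exact: mphi.
have evE r : forall k x, P (ev k r x) =
    (mu (x 0%N) * \prod_(i < k) transition_probability q (t i.+1 - t i) (x i) (x i.+1) *
      deadline_value r k (t k) (x k))%:E.
  elim: r => [|r IH] k x.
    rewrite /= mulr1 -(mjp_finite_dimensional_laws phiP)//.
    congr (P _); apply/seteqP; split => w /=; first by case.
    by move=> h; split => // l; rewrite addn0 ltnNge; case: leqP.
  rewrite (@probability_partition _ _ _ P _ (phi (t k.+1)))//; last first.
    by move=> y; exact: mphi.
  pose x' y i := if i == k.+1 then y else x i.
  transitivity (\sum_y (mu (x 0%N) * \prod_(i < k)
      transition_probability q (t i.+1 - t i) (x i) (x i.+1) *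
      (transition_probability q (a k - t k) (x k) y *
      (if ok k y then deadline_value r k.+1 (a k) y else 0)))%:E)%E; last first.
    by rewrite sumEFin /= mulr_sumr.
  apply: eq_bigr => y _; case: ifPn => [oky|noky]; last first.
    rewrite !mulr0 (_ : _ `&` _ = set0) ?measure0//.
    apply/seteqP; split => // w [[_ h] /= phiy].
    have := h k; rewrite leqnn addnS ltnS leq_addr => /(_ isT).
    by rewrite -[a k]/(t k.+1) phiy (negbTE noky).
  transitivity (P (ev k.+1 r (x' y))).
    congr (P _); apply/seteqP; split => w.
    - move=> [[h1 h2] /= phiy]; split.
        move=> i; rewrite leq_eqVlt => /predU1P[->|]; rewrite /x' ?eqxx//.
        rewrite ltnS => ik; rewrite ltn_eqF//; exact: h1.
      move=> l /andP[kl lk]; apply: h2; rewrite (ltnW kl).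
      by rewrite addnS -addSn.
    - move=> [h1 h2]; split.
        split.
          move=> i ik; have := h1 i (leqW ik); rewrite /x' ltn_eqF//.
        move=> l; rewrite leq_eqVlt => /andP[/predU1P[<- _|kl lk]].
          by have := h1 k.+1 (leqnn _); rewrite /x' eqxx /= => ->.
        by apply: h2; rewrite kl addSn -addnS.
      by have := h1 k.+1 (leqnn _); rewrite /x' eqxx.
  rewrite IH big_ord_recr/=; congr (_%:E).
  have x'k : x' y k.+1 = y by rewrite /x' eqxx.
  have x'lt i : (i <= k)%N -> x' y i = x i by move=> ik; rewrite /x' ltn_eqF.
  rewrite x'k !x'lt// !mulrA; congr (_ * _ * _ * _).
  by apply: eq_bigr => i _; rewrite !x'lt// ltnW.
rewrite (@probability_partition _ _ _ P _ (phi 0)); last 2 first.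
- by move=> y; exact: mphi.
- have := mall 0%N n; congr (measurable _); apply/seteqP; split => w h l ln;
  exact: h.
rewrite -sumEFin; apply: eq_bigr => y _.
transitivity (P (ev 0%N n (fun=> y))); last first.
  by rewrite evE big_ord0 mulr1.
congr (P _); apply/seteqP; split => w /=.
  by move=> [h phiy]; split => [[|]|] //.
by move=> [h1 h2]; split => //; exact: (h1 0%N).
Qed.

End FiniteMarkov.

Section PhaseDeadlines.
Context {R : realType}.
Variables (m : nat -> nat) (A : forall k, 'M[R]_(m k)).
Variables (D : forall k, 'M[R]_(m k, m k.+1)) (alpha : 'rV[R]_(m 0%N)).
Hypothesis params : phase_type_parameters A D alpha.

Lemma subgenerator_row k i : - (\sum_j A k i j) = \sum_j D k i j.
Proof.
have /matrixP/(_ i 0) := ptp_row_sums params k; rewrite !mxE.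
under eq_bigr do rewrite mxE mulr1; under [X in _ + X]eq_bigr do rewrite mxE mulr1.
by move=> /eqP; rewrite addr_eq0 => /eqP ->; rewrite opprK.
Qed.

Variable n : nat.
Hypothesis n_gt0 : (0 < n)%N.
Local Notation E := (phase_state m n).
Local Notation q := (@phase_rate R m A D n).

Lemma phase_rate_ge0 x y : x != y -> 0 <= q x y.
Proof.
have [->//|[k [kn [i ->]]]] := phase_stateP x.
have [-> _|[l [ln [j ->]]]] := phase_stateP y.
  rewrite /phase_rate /=; case: ifP => // _; rewrite mxE sumr_ge0// => j _.
  by rewrite mulr_ge0 ?(ptp_nonnegative params)// mxE ler01.
move=> xy; rewrite /phase_rate /=; apply: addr_ge0.
- have [kl|kl] := eqVneq k l; last by rewrite block_value_other// eq_sym.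
  case: _ / kl in ln j xy *; rewrite block_value_phase.
  apply: (ptp_off_diagonal params); apply: contra xy => /eqP ->.
  by rewrite (bool_irrelevance ln kn).
- have [kl|kl] := eqVneq k.+1 l; last by rewrite block_value_other// eq_sym.
  case: _ / kl in ln j xy *; rewrite block_value_phase.
  exact: (ptp_nonnegative params).
Qed.

Lemma phase_rate_backward x y : (block y < block x)%N -> q x y = 0.
Proof.
have [->//|[k [kn [i ->]]]] := phase_stateP x.
have [->|[l [ln [j ->]]]] := phase_stateP y.
  by rewrite /block /= ltnNge (ltnW kn).
rewrite /= => lk; rewrite !block_value_other ?addr0//=.
  by rewrite ltn_eqF// ltnW.
by rewrite ltn_eqF.
Qed.

Lemma phase_rate_row x : \sum_y q x y = 0.
Proof.
have [->|[k [kn [i ->]]]] := phase_stateP x.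
  by apply: big1 => y _.
under eq_bigr do rewrite -[q _ _]mulr1.
rewrite (sum_phase_rate _ _ _ _ (fun=> 1)).
have on1 l (j : 'I_(m l)) : on_block (fun=> 1 : R) j = 1 :> R.
  by rewrite /on_block; case: {-}_ / idP.
under eq_bigr do rewrite on1 mulr1.
under [X in _ + X]eq_bigr do rewrite on1 mulr1.
by rewrite -subgenerator_row subrr.
Qed.

Variable a : nat -> R.
Hypothesis a_ge0 : forall l, 0 <= a l.
Hypothesis a_mono : {homo a : i j / (i <= j)%N >-> i <= j}.

Let V (l : nat) : R -> E -> R :=
  deadline_value q a (fun l x => (l < block x)%N) (n - l) l.

Let is_derive_V l x (s : R) :
  is_derive s (1 : R) (V l ^~ x) (- \sum_z q x z * V l s z).
Proof.
rewrite /V; case: (n - l)%N => [|r]; last exact: is_derive_deadline_value.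
rewrite /= (_ : - _ = 0); first exact: is_derive_cst.
by under eq_bigr do rewrite mulr1; rewrite phase_rate_row oppr0.
Qed.

Let V_at l x : (l < n)%N ->
  V l (a l) x = if (l < block x)%N then V l.+1 (a l) x else 0.
Proof.
move=> ln; by rewrite /V (_ : (n - l = (n - l.+1).+1)%N) ?deadline_value_at// -subSn.
Qed.

(** Once block l has been left its deadline is met for good.  Both value functions
   solve the same backward system on the blocks after l, which are never left,
   and they agree at time a l; the maximum principle applies to both signs of
   their difference. *)
Let V_next l x s : (l < n)%N -> (l < block x)%N -> 0 <= s <= a l ->
  V l s x = V l.+1 s x.
Proof.
move=> ln lx sa.
have H (c : R) : 0 <= c * (V l s x - V l.+1 s x).
  apply: (@backward_comparison _ _ (fun x => l < block x)%N q
    (fun s x => c * (V l s x - V l.+1 s x))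
    (fun s x => - \sum_(z | (l < block z)%N) q x z * (c * (V l s z - V l.+1 s z)))
    (a l)) => //.
  - exact: phase_rate_ge0.
  - move=> y ly; have := phase_rate_row y.
    rewrite (bigID (fun z => l < block z)%N)/= [X in _ + X]big1.
      by rewrite addr0 => ->.
    move=> z; rewrite -leqNgt => lz.
    by rewrite phase_rate_backward// (leq_ltn_trans lz).
  - move=> y ly; apply: continuous_subspaceT => t.
    have h1 := is_derive_V l y t; have h2 := is_derive_V l.+1 y t.
    by apply: is_derive_continuous; exact: is_derive_eq.
  - move=> y t ly ta.
    have h1 := is_derive_V l y t; have h2 := is_derive_V l.+1 y t.
    apply: is_derive_eq; rewrite /GRing.scale/= opprK addrC -sumrB mulr_sumr.
    rewrite (bigID (fun z => l < block z)%N)/= [X in _ + X]big1 ?addr0; last first.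
      move=> z; rewrite -leqNgt => lz.
      by rewrite phase_rate_backward ?(leq_ltn_trans lz)// !mul0r subrr mulr0.
    by rewrite -sumrN; apply: eq_bigr => z _; ring.
  - by move=> y ly; rewrite V_at// ly subrr mulr0.
apply/eqP; rewrite eq_le -subr_ge0 -[X in _ && X]subr_ge0.
by have := H 1; have := H (-1); rewrite mul1r mulN1r opprB => -> ->.
Qed.

(** F_k is the restriction to block k of the value function for the deadlines
    from the k-th on. *)
Lemma phase_deadlines d (T : measurableType d) (P : probability T R)
    (phi : R -> T -> E) :
  markov_jump_process P (@initial_law R m alpha n) q phi ->
  exists F : forall k, R -> 'I_(m k) -> R, [/\
    P [set w | forall l, (l < n)%N -> (l < block (phi (a l) w))%N] =
      (\sum_i alpha 0 i * F 0%N 0 i)%:E,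
    forall s j, F n s j = 1,
    forall k i, (k < n)%N -> F k (a k) i = 0,
    forall k i, (k < n)%N -> {within `[0, a k], continuous (F k ^~ i)} &
    forall k i s, (k < n)%N -> 0 <= s < a k -> is_derive s 1 (F k ^~ i)
      (- (\sum_j A k i j * F k s j) - \sum_j D k i j * F k.+1 s j)].
Proof.
move=> phiP; exists (fun k s i => on_block (V k s) i); split.
- rewrite (deadline_probability (fun l x => l < block x)%N phiP)//; congr (_%:E).
  rewrite (sum_phase_state (fun x => initial_law alpha x * _)) mul0r add0r.
  have := @sum_block_value R m n 0%N (fun i => alpha 0 i) (V 0%N 0).
  by rewrite n_gt0 /V subn0 => <-.
- by move=> s j; rewrite on_block_ge// /V subnn.
- by move=> k i kn; rewrite on_blockE V_at// ltnn.
- move=> k i kn; under [X in {within _, continuous X}]eq_fun do rewrite on_blockE.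
  apply: continuous_subspaceT => s.
  exact: is_derive_continuous (is_derive_V _ _ _).
- move=> k i s kn /andP[s0 sa].
  rewrite (_ : (fun s => _) = V k ^~ (phase_at kn i)); last first.
    by apply/funext => t; rewrite on_blockE.
  have := is_derive_V k (phase_at kn i) s.
  rewrite sum_phase_rate opprD (eq_bigr (fun j => D k i j * on_block (V k.+1 s) j))//.
  move=> j _; congr (_ * _); rewrite /on_block; case: {-}_ / idP => [k1n|] //=.
    by rewrite V_next// s0 ltW.
  by move=> _; rewrite V_next// s0 ltW.
Qed.

End PhaseDeadlines.

Section PhaseComparison.
Context {R : realType}.
Variables (m : nat -> nat) (A : forall k, 'M[R]_(m k)).
Variables (D : forall k, 'M[R]_(m k, m k.+1)) (alpha : 'rV[R]_(m 0%N)).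
Hypothesis params : phase_type_parameters A D alpha.
Variables (n : nat) (a : nat -> R) (F : forall k, R -> 'I_(m k) -> R).
Arguments F : clear implicits.
Hypothesis a_mono : {homo a : i j / (i <= j)%N >-> i <= j}.
Hypothesis F_last : forall s j, F n s j = 1.
Hypothesis F_deadline : forall k i, (k < n)%N -> F k (a k) i = 0.
Hypothesis F_cont : forall k i, (k < n)%N ->
  {within `[0, a k], continuous (F k ^~ i)}.
Hypothesis F_ode : forall k i s, (k < n)%N -> 0 <= s < a k ->
  is_derive s 1 (F k ^~ i)
    (- (\sum_j A k i j * F k s j) - \sum_j D k i j * F k.+1 s j).

Let A_row k i : \sum_j A k i j <= 0.
Proof.
rewrite -oppr_ge0 (subgenerator_row params) sumr_ge0// => j _.
exact: (ptp_nonnegative params).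
Qed.

Let average (W : R) k i : \sum_j D k i j * W = - (\sum_j A k i j) * W.
Proof. by rewrite (subgenerator_row params) mulr_suml. Qed.

Let le_next k s : 0 <= s < a k -> 0 <= s <= a k.+1.
Proof.
by move=> /andP[-> /ltW sa]/=; apply: le_trans sa _; exact: a_mono.
Qed.

(** One stage of rate nu per block, by descending induction on the block k. *)
Lemma phase_le_block_stages (nu : R) : 0 < nu ->
  (forall k i, - (\sum_j A k i j) <= nu) ->
  forall r k, (r + k)%N = n -> forall i s, 0 <= s <= a k ->
  F k s i <= block_stages nu 1 r (fun l => a (l + k)%N) s.
Proof.
move=> nu0 Anu; elim=> [|r IH] k rk i s sa.
  by move: i; rewrite -(add0n k) rk => i; rewrite F_last.
have kn : (k < n)%N by rewrite -rk addSn ltnS leq_addl.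
rewrite /= add0n; set W := block_stages nu 1 r _.
have WU : unit_decreasing W by exact: block_stages_unit_decreasing.
have {}IH j t : 0 <= t < a k -> F k.+1 t j <= W t.
  move=> ta; have := IH k.+1 _ j t (le_next ta); rewrite addnS -addSn => /(_ rk).
  by under [in X in block_stages _ _ _ X]eq_fun do rewrite addnS -addSn.
have wE t : 0 <= t < a k -> is_derive t 1 (exp_stage nu (a k) W)
    (nu * (exp_stage nu (a k) W t - W t)).
  by move=> /andP[_ ta]; exact: is_derive_exp_stage.
have wW t : 0 <= t < a k -> exp_stage nu (a k) W t <= W t.
  by move=> _; exact: exp_stage_le.
have rW j t : 0 <= t < a k ->
    \sum_l D k j l * F k.+1 t l <= - (\sum_l A k j l) * W t.
  move=> ta; rewrite -average; apply: ler_sum => l _.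
  by rewrite ler_wpM2l ?IH// (ptp_nonnegative params).
have Fa j : F k (a k) j <= exp_stage nu (a k) W (a k).
  by rewrite F_deadline// exp_stage_ge0.
have wc : {within `[0, a k], continuous (exp_stage nu (a k) W)}.
  exact/continuous_subspaceT/exp_stage_continuous.
have H := exponential_upper_bound (ptp_off_diagonal params (k := k)) (@A_row k)
  (fun j => @F_cont k j kn) (fun j t => @F_ode k j t kn) (Anu k) wc wE wW rW Fa.
exact: H.
Qed.

(** Stages of rate sigma observed at time theta s have rate theta sigma < sigma,
    and a supersolution exists for that rate. *)
Lemma block_stages_le_phase (sigma theta : R) (p : nat) :
  0 < sigma -> 0 < theta < 1 -> (0 < p)%N -> (forall k, (m k <= p)%N) ->
  (forall k (z : R[i]), dominating_eigenvalue (A k) z -> complex.Re z <= - sigma) ->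
  forall r k, (r + k)%N = n -> forall i s, 0 <= s <= a k ->
  block_stages sigma p r (fun l => theta * a (l + k)%N) (theta * s) <= F k s i.
Proof.
move=> sigma0 /andP[theta0 theta1] p0 mp Asigma.
elim=> [|r IH] k rk i s /andP[s0 sa].
  by move: i; rewrite -(add0n k) rk => i; rewrite F_last.
have kn : (k < n)%N by rewrite -rk addSn ltnS leq_addl.
rewrite /= add0n; set W := block_stages sigma p r _.
have WU : unit_decreasing W by exact: block_stages_unit_decreasing.
pose w j := iter j (exp_stage sigma (theta * a k)) W.
have wU j : unit_decreasing (w j) by exact: iter_exp_stage_unit_decreasing.
have {}IH j t : 0 <= t < a k -> W (theta * t) <= F k.+1 t j.
  move=> ta; have := IH k.+1 _ j t (le_next ta); rewrite addnS -addSn => /(_ rk).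
  by under [in X in block_stages _ _ _ X]eq_fun do rewrite addnS -addSn.
have tsigma : theta * sigma < sigma by rewrite gtr_pMl.
have [v [v0 Av]] := exists_supersolution (ptp_off_diagonal params (k := k))
  (@A_row k) (Asigma k) tsigma.
move: sa; rewrite le_eqVlt => /predU1P[->|sa].
  rewrite F_deadline// -(prednK p0) iterS exp_stage_late//.
  exact: iter_exp_stage_unit_decreasing.
have scaled (f : R -> R) (df t : R) : is_derive (theta * t) 1 f df ->
    is_derive t (1 : R) (fun t : R => f (theta * t)) (theta * df).
  move=> fE; have tE : is_derive t (1 : R) (fun t : R => theta * t) theta.
    by apply: is_derive_eq; rewrite /GRing.scale/= mulr1.
  by rewrite mulrC; exact: (@is_derive1_comp _ f (fun t : R => theta * t)).
have wE j t : t < a k -> is_derive t (1 : R) (fun t : R => w j.+1 (theta * t))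
    (theta * sigma * (w j.+1 (theta * t) - w j (theta * t))).
  move=> ta; rewrite -mulrA; apply: scaled; apply: is_derive_exp_stage => //.
  by rewrite ltr_pM2l.
(* The continuation W is constant or a stage due at a later deadline. *)
have [dW [dWE dW0]] : exists dW : R -> R,
    (forall t, t < a k -> is_derive t (1 : R) (fun t : R => W (theta * t)) (dW t))
    /\ forall t, dW t <= 0.
  rewrite /W; case: r {rk W WU w wU wE IH} => [|r] /=.
    exists (fun=> 0); split => // t _; exact: is_derive_cst.
  rewrite -(prednK p0) iterS; set f := iter _ _ _.
  have fU : unit_decreasing f.
    exact/iter_exp_stage_unit_decreasing/block_stages_unit_decreasing.
  exists (fun t => theta * (sigma *
    (exp_stage sigma (theta * a (1 + k)%N) f (theta * t) - f (theta * t)))).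
  split=> t; last first.
    by rewrite 2?mulr_ge0_le0 ?(ltW theta0) ?(ltW sigma0)// subr_le0 exp_stage_le.
  move=> ta; apply: scaled; apply: is_derive_exp_stage => //.
  by rewrite ltr_pM2l// (lt_le_trans ta)// a_mono.
pose dw j t : R := if j is j'.+1
  then theta * sigma * (w j (theta * t) - w j' (theta * t)) else dW t.
have wc j : {within `[0, a k], continuous (fun t => w j (theta * t))}.
  apply: continuous_subspaceT => t.
  apply: (@continuous_comp _ _ _ (fun t : R => theta * t) (w j)).
    by apply: is_derive_continuous; exact: is_derive_eq.
  exact: unit_decreasing_continuous.
have wle j t : w j.+1 t <= w j t by exact: exp_stage_le.
have dwE j t : 0 <= t < a k ->
    is_derive t (1 : R) (fun t : R => w j (theta * t)) (dw j t).
  by move=> /andP[_ ta]; case: j => [|j]; [exact: dWE|exact: wE].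
have dw0 j t : 0 <= t < a k -> dw j t <= 0.
  move=> _; case: j => [|j] /=; first exact: dW0.
  by apply: mulr_ge0_le0; [rewrite mulr_ge0 ?ltW|rewrite subr_le0; exact: wle].
have dwE' j t : 0 <= t < a k -> dw j.+1 t =
    theta * sigma * (w j.+1 (theta * t) - w j (theta * t)) by [].
have wle' j t : 0 <= t < a k -> w j.+1 (theta * t) <= w j (theta * t) by [].
have w0 : 0 <= w 0%N (theta * a k) by exact: unit_decreasing_ge0.
have wa j : w j.+1 (theta * a k) = 0 by exact: exp_stage_late.
have rW j t : 0 <= t < a k ->
    - (\sum_l A k j l) * w 0%N (theta * t) <= \sum_l D k j l * F k.+1 t l.
  move=> ta; rewrite -average; apply: ler_sum => l _.
  by rewrite ler_wpM2l ?IH// (ptp_nonnegative params).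
have Fa j : 0 <= F k (a k) j by rewrite F_deadline.
have := exponential_stages_lower_bound (ptp_off_diagonal params (k := k))
  (@A_row k) (fun j => @F_cont k j kn) (fun j t => @F_ode k j t kn) v0 Av wc dwE
  dw0 dwE' wle' w0 wa rW Fa.
rewrite card_ord => /(_ i s) H; apply: le_trans (H _); last by rewrite s0.
exact: iter_exp_stage_le.
Qed.

End PhaseComparison.

(** * Occupation times *)

Section RightContinuousPaths.
Context {R : realType} {E : finType}.
Context {d : measure_display} {T : measurableType d}.
Variable phi : R -> T -> E.
Hypothesis mphi : forall t x, 0 <= t -> measurable [set w | phi t w = x].
Hypothesis rphi : forall w t, 0 <= t -> \forall s \near t^'+, phi s w = phi t w.

Lemma right_constant w t : 0 <= t ->
  exists2 e : R, 0 < e & forall s, t <= s < t + e -> phi s w = phi t w.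
Proof.
move=> t0; have [e /= e0 eP] := rphi w t0.
exists e => // s /andP[]; rewrite le_eqVlt => /predU1P[<-//|ts] ste.
by apply: eP => //=; rewrite ltr0_norm ?subr_lt0// opprB ltrBlDl.
Qed.

(** Approximate s from the right by the grid of mesh 1 / (M + 1): right
    continuity makes the approximation exact for large M, and the path is
    observed at countably many times for each M. *)
Lemma measurable_path_set (G : pred E) :
  measurable [set z : measurableTypeR R * T | 0 <= z.1 /\ G (phi z.1 z.2)].
Proof.
pose S M := \bigcup_j
  ([set s : measurableTypeR R | s \in `[j%:R / M.+1%:R, j.+1%:R / M.+1%:R[%R] `*`
   [set w | G (phi (j.+1%:R / M.+1%:R) w)]).
have mS M : measurable (S M).
  apply: bigcupT_measurable => j; apply: measurableX; first exact: measurable_itv.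
  by apply: measurable_fibers => x; apply: mphi; rewrite divr_ge0.
suff -> : [set z : measurableTypeR R * T | 0 <= z.1 /\ G (phi z.1 z.2)] =
    \bigcup_M0 \bigcap_(M in [set M | (M0 <= M)%N]) S M.
  apply: bigcupT_measurable => M0; apply: bigcap_measurable => //.
  by exists M0 => /=.
have SE M s w : 0 <= s -> S M (s, w) <->
    G (phi ((Num.truncn (s * M.+1%:R)).+1%:R / M.+1%:R) w).
  move=> s0; have M0 : 0 < M.+1%:R :> R by [].
  have sM0 : 0 <= s * M.+1%:R by rewrite mulr_ge0.
  have := truncn_itv sM0; rewrite -/(Num.truncn _) => sj.
  split=> [[j _ [/= sj' Gj]]|Gs].
    suff <- : j = Num.truncn (s * M.+1%:R) by [].
    apply/esym/truncn_def; move: sj'.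
    by rewrite in_itv/= ler_pdivrMr// ltr_pdivlMr.
  exists (Num.truncn (s * M.+1%:R)) => //; split => //=.
  by rewrite in_itv/= ler_pdivrMr// ltr_pdivlMr.
have near_grid s w : 0 <= s -> exists M0 : nat, forall M, (M0 <= M)%N ->
    phi ((Num.truncn (s * M.+1%:R)).+1%:R / M.+1%:R) w = phi s w.
  move=> s0; have [e e0 eP] := right_constant w s0.
  exists (Num.truncn e^-1).+1 => M M0M; apply: eP.
  have Mp : 0 < M.+1%:R :> R by [].
  have := truncn_itv (mulr_ge0 s0 (ltW Mp)) => /andP[j1 j2].
  rewrite ler_pdivlMr// (ltW j2)/= ltr_pdivrMr// mulrDl -natr1.
  rewrite ler_ltD//; have e0' : 0 <= e^-1 by rewrite invr_ge0 ltW.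
  have /andP[_ h] := truncn_itv e0'.
  rewrite mulrC -ltr_pdivrMr// div1r (lt_le_trans h)// ler_nat.
  exact: leq_trans M0M _.
apply/seteqP; split => [[s w] /= [s0 Gs]|[s w] [M0 _ h]].
  have [M0 M0P] := near_grid s w s0.
  by exists M0 => // M /= M0M; apply/SE => //; rewrite M0P.
have s0 : 0 <= s.
  have [j _ [/= + _]] := h M0 (leqnn _).
  by rewrite in_itv/= => /andP[+ _]; apply: le_trans; rewrite divr_ge0.
split => //=; have [M1 M1P] := near_grid s w s0.
have := h (maxn M0 M1) (leq_maxl _ _); move/SE => /(_ s0).
by rewrite M1P// leq_maxr.
Qed.

End RightContinuousPaths.

Section OccupationTimes.
Context {R : realType}.
Variables (m : nat -> nat) (A : forall k, 'M[R]_(m k)).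
Variables (D : forall k, 'M[R]_(m k, m k.+1)) (alpha : 'rV[R]_(m 0%N)).
Variable n : nat.
Local Notation E := (phase_state m n).
Local Notation q := (@phase_rate R m A D n).

(** A jump never decreases the block, so neither does a power of the generator. *)
Lemma transition_probability_backward t x y : (block y < block x)%N ->
  transition_probability q t x y = 0.
Proof.
move=> yx; rewrite /transition_probability expmx_scale.
apply: cvg_lim => //; rewrite [X in X @ _](_ : _ = fun=> 0); first exact: cvg_cst.
apply/funext => N; apply: big1 => k _ /=.
suff -> : (generator_mx q ^+ k) (enum_rank x) (enum_rank y) = 0.
  by rewrite !mul0r.
elim: k x yx => [|k IH] x yx.
  rewrite (_ : _ ^+ 0 = 1%:M)// mxE (can_eq enum_rankK).
  by case: eqVneq yx => [->|//]; rewrite ltnn.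
rewrite (_ : _ ^+ k.+1 = generator_mx q *m generator_mx q ^+ k); last by rewrite exprS.
rewrite mxE big1// => z' _; rewrite -(enum_valK z'); set z := enum_val z'.
rewrite mxE !enum_rankK; have [zx|xz] := ltnP (block z) (block x).
  by rewrite phase_rate_backward// mul0r.
by rewrite IH ?mulr0// (leq_trans yx).
Qed.

Context {d : measure_display} {T : measurableType d}.
Variables (P : probability T R) (phi : R -> T -> E).
Hypothesis phiP : markov_jump_process P (@initial_law R m alpha n) q phi.

Let mphi t x : 0 <= t -> measurable [set w | phi t w = x].
Proof. exact: (mjp_measurable phiP). Qed.

Let rphi w t : 0 <= t -> \forall s \near t^'+, phi s w = phi t w.
Proof. exact: (mjp_right_continuous phiP). Qed.

Definition increasing_blocks : set T := [set w | forall s t, 0 <= s <= t ->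
  (block (phi s w) <= block (phi t w))%N].

(** Almost surely the block number increases along rational times, hence, by
    right continuity, along all times. *)
Lemma increasing_blocks_ae : exists2 N : set T, measurable N &
  P N = 0%E /\ ~` N `<=` increasing_blocks.
Proof.
pose B (z : rat * rat) := [set w | (0 <= z.1 <= z.2)%R /\
  (block (phi (ratr z.2) w) < block (phi (ratr z.1) w))%N].
have mB z : measurable (B z).
  rewrite /B; case: (boolP (0 <= z.1 <= z.2)) => [/andP[z1 z12]|_]; last first.
    by rewrite (_ : [set w | _] = set0)//; apply/seteqP; split => w // [].
  rewrite (_ : [set w | _] = \bigcup_(x in [set: E]) ([set w | phi (ratr z.1) w = x] `&`
    [set w | (fun y => block y < block x)%N (phi (ratr z.2) w)])).
    apply: fin_bigcup_measurable => // x _; apply: measurableI.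
      by apply: mphi; rewrite ler0q.
    apply: (measurable_fibers (fun y => (block y < block x)%N)) => y.
    by apply: mphi; rewrite ler0q (le_trans z1).
  apply/seteqP; split => w /=; last by move=> [x _ [<- ?]].
  by move=> [_ h]; exists (phi (ratr z.1) w).
have B0 z : P (B z) = 0%E.
  have [/andP[z1 z12]|z12] := boolP (0 <= z.1 <= z.2); last first.
    rewrite (_ : B z = set0) ?measure0//; apply/seteqP; split => w // [].
    by rewrite (negbTE z12).
  have t1 : 0 <= ratr z.1 :> R by rewrite ler0q.
  have t2 : 0 <= ratr z.2 :> R by rewrite ler0q (le_trans z1).
  have mI F t x : measurable F -> 0 <= t -> measurable (F `&` [set w | phi t w = x]).
    by move=> mF t0; apply: measurableI => //; exact: mphi.
  rewrite (@probability_partition _ _ _ P _ (phi 0) (B z))//; last by move=> x; exact: mphi.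
  apply: big1 => x0 _.
  rewrite (@probability_partition _ _ _ P _ (phi (ratr z.1)))//; last 2 first.
  - by move=> x; exact: mphi.
  - exact: mI.
  apply: big1 => x _.
  rewrite (@probability_partition _ _ _ P _ (phi (ratr z.2))); last 2 first.
  - by move=> y; exact: mphi.
  - by apply: (mI) => //; exact: mI.
  apply: big1 => y _.
  have [yx|xy] := ltnP (block y) (block x); last first.
    rewrite (_ : _ `&` _ = set0) ?measure0//; apply/seteqP; split => w //=.
    by move=> [[[[_ h] _] h1] h2]; move: h; rewrite h1 h2 ltnNge xy.
  pose t i : R := if i is i'.+1 then if i' is _.+1 then ratr z.2 else ratr z.1 else 0.
  pose X i : E := if i is i'.+1 then if i' is _.+1 then y else x else x0.
  have tmono : {homo t : i j / (i <= j)%N >-> i <= j}.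
    by move=> [|[|i]] [|[|j]] //= _; rewrite ler_rat.
  have := mjp_finite_dimensional_laws phiP 2 X (erefl : t 0%N = 0) tmono.
  rewrite !big_ord_recr big_ord0/= mul1r (transition_probability_backward _ yx).
  rewrite !mulr0 => F0.
  apply/eqP; rewrite eq_le measure_ge0 andbT.
  apply: (@le_trans _ _ (P [set w | forall i, (i <= 2)%N -> phi (t i) w = X i]));
    last by rewrite F0.
  apply: le_measure.
  - by rewrite inE; apply: (mI) => //; apply: (mI) => //; exact: mI.
  - rewrite inE; apply: (@measurable_forall_lt _ _ 3 (fun i => [set w | phi (t i) w = X i])).
    move=> [|[|[|i]]] // _; exact: mphi.
  - move=> w [[[_ h0] h1] h2] [|[|[|i]]] //.
pose B' i := if unpickle i is Some z then B z else set0.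
have mB' i : measurable (B' i) by rewrite /B'; case: unpickle.
exists (\bigcup_i B' i); first exact: bigcupT_measurable.
split.
  apply: measure_negligible; first exact: bigcupT_measurable.
  apply: negligible_bigcup => i; apply/negligibleP => //.
  by rewrite /B'; case: unpickle => // z; rewrite B0.
move=> w Bw s t /andP[s0 st].
have t0 := le_trans s0 st.
move: st; rewrite le_eqVlt => /predU1P[->//|st].
rewrite leqNgt; apply/negP => ts.
have [e e0 eP] := right_constant rphi w s0.
have [e' e0' eP'] := right_constant rphi w t0.
have [q1 sq1] : exists q1 : rat, ratr q1 \in `]s, Num.min (s + e) t[%R.
  by apply: rat_in_itvoo; rewrite lt_min ltrDl e0.
have [q2 tq2] : exists q2 : rat, ratr q2 \in `]t, t + e'[%R.
  by apply: rat_in_itvoo; rewrite ltrDl.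
move: sq1; rewrite in_itv/= lt_min => /and3P[sq1 q1e q1t].
move: tq2; rewrite in_itv/= => /andP[tq2 q2e].
apply: Bw; exists (pickle (q1, q2)); first exact: I.
have -> : B' (pickle (q1, q2)) = B (q1, q2) by rewrite /B' pickleK.
split; rewrite [(_, _).1]/= [(_, _).2]/=.
  rewrite -(ler0q R) (le_trans s0 (ltW sq1))/= -(ler_rat R).
  by rewrite (le_trans (ltW q1t))// ltW.
by rewrite (eP (ratr q1)) ?(eP' (ratr q2))// ?(ltW tq2) ?(ltW sq1).
Qed.

Let path_set (G : pred E) (w : T) : set (measurableTypeR R) :=
  [set s | 0 <= s /\ G (phi s w)].

Let path_setE G w : path_set G w =
  ysection [set z : measurableTypeR R * T | 0 <= z.1 /\ G (phi z.1 z.2)] w.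
Proof. by apply/seteqP; split=> s; rewrite /ysection/= inE. Qed.

Let measurable_path_section G w : measurable (path_set G w).
Proof. by rewrite path_setE; apply: measurable_ysection; exact: (measurable_path_set mphi rphi). Qed.

Let occupation_timeE k w :
  occupation_time phi k w = lebesgue_measure (path_set (in_block k) w).
Proof.
transitivity (\int[lebesgue_measure]_(s in `[0%R, +oo[)
    (\1_(path_set (in_block k) w) s)%:E)%E.
  apply: eq_integral => s; rewrite inE/= in_itv/= andbT => s0.
  by congr (_%:E); apply: eq_indic; split => [|[]].
rewrite integral_indic//; congr (lebesgue_measure _).
by apply/seteqP; split => [s []|s [s0 Gs]]//; split => //=; rewrite in_itv/= s0.
Qed.

Lemma measurable_occupation_time k : measurable_fun setT (occupation_time phi k).
Proof.
rewrite (_ : occupation_time phi k = lebesgue_measure \o ysection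
    [set z : measurableTypeR R * T | 0 <= z.1 /\ in_block k (phi z.1 z.2)]).
  by apply: measurable_fun_ysection; exact: (measurable_path_set mphi rphi).
by apply/funext => w; rewrite occupation_timeE path_setE.
Qed.

Lemma sum_occupation_time l w : (l < n)%N ->
  (\sum_(k < n | (k <= l)%N) occupation_time phi k w =
   lebesgue_measure (path_set (fun x => block x <= l)%N w))%E.
Proof.
move=> ln; under eq_bigr do rewrite occupation_timeE.
rewrite -measure_bigsetU_ord_cond//; last first.
  move=> i j _ _ [s [[_ h1] [_ h2]]].
  by move: h1 h2; rewrite /in_block; case: (phi s w) => // y /eqP <- /eqP.
congr (lebesgue_measure _); rewrite -bigcup_seq_cond.
apply/seteqP; split => s /=.
  move=> [k /= /andP[_ kl] [s0 h]]; split => //.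
  by move: h; rewrite /in_block /block; case: (phi s w) => // y /eqP ->.
move=> [s0]; rewrite /block; case phis : (phi s w) => [y|]; last first.
  by rewrite leqNgt ln.
move=> yl; exists (tag y); first by rewrite /= mem_index_enum.
by split => //; rewrite /in_block phis.
Qed.

(** The time spent in the blocks up to l is the length of an initial interval.
    If block l has not been left at time b, right continuity keeps the path in
    these blocks a little longer, so that the length exceeds b strictly. *)
Lemma occupation_time_le l (b : R) w : increasing_blocks w -> (l < n)%N -> 0 <= b ->
  (\sum_(k < n | (k <= l)%N) occupation_time phi k w <= b%:E)%E <->
  (l < block (phi b w))%N.
Proof.
move=> w_incr ln b0; rewrite sum_occupation_time//.
have [lb|bl] := ltnP l (block (phi b w)); split => //.
  move=> _; apply: (@le_trans _ _ (lebesgue_measure (`[0, b]%classic : set R))).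
    apply: le_measure; rewrite ?inE//.
    move=> s [s0 sl] /=; rewrite in_itv/= s0 leNgt; apply/negP => bs.
    have := w_incr b s; rewrite b0 (ltW bs) => /(_ isT).
    by rewrite leqNgt (leq_ltn_trans sl lb).
  by rewrite lebesgue_measure_itv/= lte_fin; case: ifP => // _; rewrite sube0.
move=> H; exfalso; move: H; apply/negP; rewrite -ltNge.
have [e e0 eP] := right_constant rphi w b0.
apply: (@lt_le_trans _ _ (lebesgue_measure (`[0, b + e[%classic : set R))).
  rewrite lebesgue_measure_itv/= lte_fin ltr_wpDl// sube0 lte_fin.
  by rewrite ltrDl.
apply: le_measure; rewrite ?inE//.
move=> s /=; rewrite in_itv/= => /andP[s0 sbe]; split => //.
have [bs|sb] := leP b s; first by rewrite eP// bs.
by rewrite (leq_trans _ bl)// w_incr// s0 ltW.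
Qed.

Lemma occupation_deadlines (a : nat -> R) : (forall l, 0 <= a l) ->
  P [set w | forall l, (l < n)%N ->
    (\sum_(k < n | (k <= l)%N) occupation_time phi k w <= (a l)%:E)%E] =
  P [set w | forall l, (l < n)%N -> (l < block (phi (a l) w))%N].
Proof.
move=> a0; have [N mN [N0 NP]] := increasing_blocks_ae.
set U := [set w | _]; set U' := [set w | _].
have mU : measurable U.
  apply: (@measurable_forall_lt _ _ n (fun l => [set w |
    (\sum_(k < n | (k <= l)%N) occupation_time phi k w <= (a l)%:E)%E])) => l _.
  rewrite -[X in measurable X]setTI; apply: measurable_lee => //.
  rewrite (_ : (fun w => _) = (fun w => \sum_(k < n)
      (if (k <= l)%N then occupation_time phi k w else 0))%E); last first.
    by apply/funext => w; rewrite big_mkcond.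
  apply: emeasurable_sum => k; case: (k <= l)%N => //.
  exact: measurable_occupation_time.
have mU' : measurable U'.
  apply: (@measurable_forall_lt _ _ n (fun l => [set w |
    (fun x => l < block x)%N (phi (a l) w)])) => l _.
  by apply: (measurable_fibers (fun x => l < block x)%N) => x; exact: mphi.
have UU' w : ~ N w -> U w <-> U' w.
  by move=> /NP w_incr; split => h l ln; apply/(occupation_time_le w_incr ln (a0 l)); exact: h.
exact: probability_eq_off_null mN N0 mU mU' UU'.
Qed.

End OccupationTimes.

(** * From deadlines to ruin *)

Section RuinComparison.
Context {R : realType} {d : measure_display} {T : measurableType d}.
Variable P : probability T R.
Variables (u c lambda : R) (N : R -> T -> nat).
Hypotheses (u_ge0 : 0 <= u) (c_gt0 : 0 < c).
Hypothesis N_poisson : poisson_process P lambda N.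

(** An enumeration of the nonnegative rational numbers. *)
Definition rational_time (i : nat) : R :=
  `|ratr (odflt 0 (unpickle i : option rat))|.

Let b i := u + c * rational_time i.

Let b_ge0 i : 0 <= b i.
Proof. by rewrite /b addr_ge0// mulr_ge0 ?normr_ge0// ltW. Qed.

(** Ruin seen at one of the first j rational times, by fewer than j claims: these
    events depend on finitely many variables and increase to ruin. *)
Definition ruin_before (X : nat -> {RV P >-> R}) (j : nat) : set T :=
  [set w | exists i, [/\ (i < j)%N, (N (rational_time i) w < j)%N &
    b i < \sum_(k < N (rational_time i) w) X k w]].

(** Ruin is visible at a rational time because the counting process is right
    continuous and the premium moves the level continuously. *)
Lemma ruin_event_bigcup (X : nat -> {RV P >-> R}) :
  ruin_event (risk_process u c N X) = \bigcup_j ruin_before X j.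
Proof.
apply/seteqP; split => w.
  move=> /ereal_inf_lt[_ [t /= t0 <-]]; rewrite lte_fin /risk_process subr_lt0 => tS.
  have [e /= e0 eP] := poisson_process_right_continuous N_poisson w t0.
  set S := \sum_(k < N t w) X k w in tS.
  have [r tr] : exists r : rat, ratr r \in `]t, Num.min (t + e) ((S - u) / c)[%R.
    apply: rat_in_itvoo; rewrite lt_min ltrDl e0/= ltr_pdivlMr// mulrC.
    by rewrite ltrBrDl.
  move: tr; rewrite in_itv/= lt_min => /and3P[tr rte rS].
  have r0 : 0 <= ratr r :> R := le_trans t0 (ltW tr).
  have rE : rational_time (pickle r) = ratr r.
    by rewrite /rational_time pickleK/= ger0_norm.
  have Nr : N (ratr r) w = N t w.
    by apply: eP => //=; rewrite ltr0_norm ?subr_lt0// opprB ltrBlDl.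
  exists (maxn (pickle r) (N t w)).+1 => //; exists (pickle r).
  rewrite rE Nr !ltnS leq_maxl leq_maxr; split => //.
  by rewrite /b rE -ltrBrDl mulrC -ltr_pdivlMr.
move=> [j _ [i [_ _ bS]]].
apply: (@le_lt_trans _ _ (risk_process u c N X (rational_time i) w)%:E).
  by apply: ereal_inf_lbound; exists (rational_time i) => //=; rewrite /rational_time.
by rewrite lte_fin /risk_process subr_lt0.
Qed.

Definition crossing (X : nat -> {RV P >-> R}) j (nu : {ffun 'I_j -> 'I_j.+1}) : set T :=
  [set w | exists2 i : 'I_j, (nu i < j)%N & b i < \sum_(k < nu i) X k w].

(** All counts of at least j are merged into one value, so that the
    counts take finitely many values. *)
Definition capped_counts j (w : T) : {ffun 'I_j -> 'I_j.+1} :=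
  [ffun i : 'I_j => inord (minn (N (rational_time i) w) j)].

Lemma crossingE X j (nu : {ffun 'I_j -> 'I_j.+1}) w : capped_counts j w = nu ->
  ruin_before X j w <-> crossing X nu w.
Proof.
move=> wnu.
have nuE (i : 'I_j) : nu i = minn (N (rational_time i) w) j :> nat.
  by rewrite -wnu ffunE inordK// ltnS geq_minr.
split=> [[i [ij Nj bS]]|[i nuj bS]].
  have E : nu (Ordinal ij) = N (rational_time i) w :> nat.
    by rewrite nuE; apply/minn_idPl/ltnW.
  by exists (Ordinal ij); rewrite E.
move: (nuE i) nuj bS => /=; rewrite /minn; case: ltnP => [h E|h ->]; last by rewrite ltnn.
by rewrite E => h' bS; exists i; split.
Qed.

Lemma crossing_process_measurable (X : nat -> {RV P >-> R}) j (nu : {ffun 'I_j -> 'I_j.+1}) :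
  process_sigma_algebra [set k : nat | (k < j.+1)%N] (fun k => X k : T -> R)
    (crossing X nu).
Proof.
pose TX := process_sigma_type [set k : nat | (k < j.+1)%N] (fun k => X k : T -> R).
suff : @measurable _ TX (crossing X nu) by [].
have mS (i : 'I_j) : measurable_fun [set: TX] (fun w : TX => \sum_(k < nu i) X k w).
  apply: measurable_sum => k.
  apply: (process_sigma_type_measurable (X := fun k => X k : T -> R)).
  exact: leq_trans (ltn_ord k) (ltnW (ltn_ord (nu i))).
rewrite (_ : crossing X nu = \bigcup_(i in [set` [seq i <- enum 'I_j | (nu i < j)%N]])
    ~` [set w : TX | \sum_(k < nu i) X k w <= b i]).
  apply: fin_bigcup_measurable; first exact: finite_seq.
  by move=> i _; apply: measurableC; exact: measurable_le_set.
apply/seteqP; split => w.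
  move=> [i ij bS]; exists i; first by rewrite /= mem_filter ij mem_enum.
  by apply/negP; rewrite -ltNge.
case=> i; rewrite /= mem_filter => /andP[ij _] /negP; rewrite -ltNge => bS.
by exists i.
Qed.

Lemma capped_counts_process_measurable j (nu : {ffun 'I_j -> 'I_j.+1}) :
  process_sigma_algebra [set t : R | 0 <= t] N [set w | capped_counts j w = nu].
Proof.
pose TN := process_sigma_type [set t : R | 0 <= t] N.
suff : @measurable _ TN [set w | capped_counts j w = nu] by [].
rewrite (_ : [set w | _] = \bigcap_(i in [set` enum 'I_j])
    [set w : TN | inord (minn (N (rational_time i) w) j) = nu i]); last first.
  apply/seteqP; split => w /=.
    by move=> <- i _; rewrite /= ffunE.
  by move=> h; apply/ffunP => i; rewrite ffunE h//= mem_enum.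
rewrite bigcap_seq; apply: bigsetI_measurable => i _.
have : measurable_fun [set: TN] (N (rational_time i)).
  by apply: process_sigma_type_measurable => /=; rewrite /rational_time.
move=> /(_ measurableT [set k | inord (minn k j) = nu i]); rewrite setTI.
exact.
Qed.

Definition met_deadlines (X : nat -> {RV P >-> R}) (n : nat) (a : nat -> R) : set T :=
  [set w | forall l, (l < n)%N -> \sum_(k < l.+1) X k w <= a l].

Lemma measurable_met_deadlines X n a : measurable (met_deadlines X n a).
Proof.
apply: (@measurable_forall_lt _ _ n
  (fun l => [set w | \sum_(k < l.+1) X k w <= a l])) => l _.
by apply: measurable_le_set; exact: measurable_sum.
Qed.

Section Deadlines.
Variables (j : nat) (nu : {ffun 'I_j -> 'I_j.+1}).

Let last_level := \max_(i < j | (nu i < j)%N) nu i.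

(** The tightest level among those that concern at least l + 1 claims.  The sum of
   all levels, an upper bound for each of them, is the value for an empty
   minimum. *)
Let deadline (l : nat) : R :=
  \big[Num.min/(\sum_(i < j) b i)]_(i < j | (nu i < j)%N && (l < nu i)%N) b i.

Let deadline_ge0 l : 0 <= deadline l.
Proof. by apply: le_bigmin => [|i _]; rewrite ?sumr_ge0. Qed.

Let deadline_homo : {homo deadline : l l' / (l <= l')%N >-> l <= l'}.
Proof.
move=> l l' ll'; apply: le_bigmin => [|i /andP[ij li]].
  exact: bigmin_le_id.
by apply: bigmin_le_cond; rewrite ij (leq_ltn_trans ll').
Qed.

(** Nonnegative claims have nondecreasing partial sums, which makes the constraint
   on a sum bind all shorter ones. *)
Let crossingC (X : nat -> {RV P >-> R}) w : (forall k, 0 <= X k w) ->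
  ~ crossing X nu w <-> met_deadlines X last_level deadline w.
Proof.
move=> X0.
have Smono l l' : (l <= l')%N -> \sum_(k < l) X k w <= \sum_(k < l') X k w.
  move=> ll'; rewrite (big_ord_widen _ (fun k => X k w) ll') big_mkcond/=.
  by apply: ler_sum => k _; case: ifP.
split=> [nc l ll|h [i ij bS]].
  have [i ij li] : exists2 i : 'I_j, (nu i < j)%N & (l < nu i)%N.
    apply: contrapT => H; move: ll; rewrite ltnNge => /negP; apply.
    apply/bigmax_leqP => i ij; rewrite leqNgt; apply/negP => li.
    by apply: H; exists i.
  have Sb i' : (nu i' < j)%N -> (l < nu i')%N -> \sum_(k < l.+1) X k w <= b i'.
    move=> ij' li'; rewrite (le_trans (Smono _ _ li'))// leNgt; apply/negP => bS.
    by apply: nc; exists i'.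
  apply: le_bigmin => [|i' /andP[ij' li']]; last exact: Sb.
  apply: le_trans (Sb i ij li) _; rewrite (bigD1 i)//= lerDl.
  by rewrite sumr_ge0.
move: bS; apply/negP; rewrite -leNgt; case: (posnP (nu i)) => [->|nui].
  by rewrite big_ord0.
rewrite -(prednK nui); apply: le_trans (h _ _) _.
  rewrite prednK//; exact: (leq_bigmax_cond (P := fun i => (nu i < j)%N) (F := fun i => nat_of_ord (nu i)) i).
by apply: bigmin_le_cond; rewrite ij/= ltn_predL.
Qed.

Lemma measurable_crossing (X : nat -> {RV P >-> R}) : measurable (crossing X nu).
Proof.
have mX k : [set k : nat | (k < j.+1)%N] k -> measurable_fun setT (X k).
  by move=> _; exact: measurable_funP.
exact: (process_sigma_algebra_measurable mX (crossing_process_measurable nu)).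
Qed.

Lemma probability_crossing_le (X X' : nat -> {RV P >-> R}) :
  (forall k, P [set w | X k w < 0] = 0%E) ->
  (forall k, P [set w | X' k w < 0] = 0%E) ->
  (forall n a, (0 < n)%N -> (forall l, 0 <= a l) ->
    {homo a : i j / (i <= j)%N >-> i <= j} ->
    (P (met_deadlines X' n a) <= P (met_deadlines X n a))%E) ->
  (P (crossing X nu) <= P (crossing X' nu))%E.
Proof.
move=> X0 X'0 XX'.
have neg0 (Z : nat -> {RV P >-> R}) : (forall k, P [set w | Z k w < 0] = 0%E) ->
    P (crossing Z nu) = (1 - P (met_deadlines Z last_level deadline))%E.
  move=> Z0; rewrite -probability_setC; last exact: measurable_met_deadlines.
  have mneg k : measurable [set w | Z k w < 0] by exact: measurable_lt0.
  apply: (@probability_eq_off_null _ _ _ P (\bigcup_k [set w | Z k w < 0])) => //.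
  - exact: bigcupT_measurable.
  - apply: measure_negligible; first exact: bigcupT_measurable.
    by apply: negligible_bigcup => k; apply/negligibleP; [exact: mneg|exact: Z0].
  - exact: measurable_crossing.
  - by apply: measurableC; exact: measurable_met_deadlines.
  move=> w Zw; have Zw0 k : 0 <= Z k w.
    by rewrite leNgt; apply/negP => Zk; apply: Zw; exists k.
  have := crossingC Zw0; rewrite /setC/= => <-; split=> [h|]; first by apply.
  exact: contrapT.
rewrite !neg0//; apply: leeB => //.
have [n0|n0] := posnP last_level; last exact: XX'.
have all Z : met_deadlines Z 0 deadline = setT by apply/seteqP; split.
by rewrite n0 !all.
Qed.

End Deadlines.

Definition independent_of_counts (X : nat -> {RV P >-> R}) : Prop :=
  forall n : nat, (0 < n)%N -> independent_sigma_algebras P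
    (process_sigma_algebra [set k : nat | (k < n)%N] (fun k => X k : T -> R))
    (process_sigma_algebra [set t : R | 0 <= t] N).

Let measurable_capped j nu : measurable [set w | capped_counts j w = nu].
Proof.
exact: (process_sigma_algebra_measurable (poisson_process_measurable N_poisson)
  (capped_counts_process_measurable nu)).
Qed.

Lemma measurable_ruin_before (X : nat -> {RV P >-> R}) j :
  measurable (ruin_before X j).
Proof.
rewrite (_ : ruin_before X j = \bigcup_(nu in [set: {ffun 'I_j -> 'I_j.+1}])
  (crossing X nu `&` [set w | capped_counts j w = nu])).
  apply: fin_bigcup_measurable => // nu _; apply: measurableI => //.
  exact: measurable_crossing.
apply/seteqP; split => w; last by case=> nu _ [h wnu]; exact/(crossingE _ wnu).
move=> h; exists (capped_counts j w) => //; split => //.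
exact/(crossingE X (erefl _)).
Qed.

(** Given the capped counts, ruin before j is a crossing by the claims alone, and
    independence factorises its probability. *)
Lemma ruin_probability_le (X X' : nat -> {RV P >-> R}) :
  independent_of_counts X -> independent_of_counts X' ->
  (forall k, P [set w | X k w < 0] = 0%E) ->
  (forall k, P [set w | X' k w < 0] = 0%E) ->
  (forall n a, (0 < n)%N -> (forall l, 0 <= a l) ->
    {homo a : i j / (i <= j)%N >-> i <= j} ->
    (P (met_deadlines X' n a) <= P (met_deadlines X n a))%E) ->
  ruin_probability P (risk_process u c N X) u <=
  ruin_probability P (risk_process u c N X') u.
Proof.
move=> Xind X'ind X0 X'0 XX'.
have before_le j : (P (ruin_before X j) <= P (ruin_before X' j))%E.
  have split_before (Z : nat -> {RV P >-> R}) : independent_of_counts Z ->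
      P (ruin_before Z j) = (\sum_(nu : {ffun 'I_j -> 'I_j.+1})
        P (crossing Z nu) * P [set w | capped_counts j w = nu])%E.
    move=> Zind; rewrite (@probability_partition _ _ _ P _ (capped_counts j)); last 2 first.
    - exact: measurable_capped.
    - exact: measurable_ruin_before.
    apply: eq_bigr => nu _; rewrite -(Zind j.+1)//; last 2 first.
    - exact: crossing_process_measurable.
    - exact: capped_counts_process_measurable.
    congr (P _); apply/seteqP; split => w [h wnu]; split => //.
      exact/(crossingE Z wnu).
    exact/(crossingE Z wnu).
  rewrite !split_before//; apply: lee_sum => nu _.
  by rewrite lee_wpmul2r// probability_crossing_le.
have ruin_le : (P (ruin_event (risk_process u c N X)) <=
    P (ruin_event (risk_process u c N X')))%E.
  have mono (Z : nat -> {RV P >-> R}) :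
      {homo ruin_before Z : i j / (i <= j)%N >-> (i <= j)%O}.
    move=> i j ij; apply/subsetPset => w [k [ki Ni bS]]; exists k.
    by split => //; [exact: leq_trans ij|exact: leq_trans ij].
  rewrite !ruin_event_bigcup.
  have cX := nondecreasing_cvg_mu (mu := P) (measurable_ruin_before X)
    (bigcupT_measurable _ (measurable_ruin_before X)) (mono X).
  rewrite -(cvg_lim _ cX)//; apply: lime_le; first by apply/cvg_ex; eexists; exact: cX.
  apply: nearW => j /=; apply: le_trans (before_le j) _.
  apply: le_measure; rewrite ?inE.
  - exact: measurable_ruin_before.
  - by apply: bigcupT_measurable => j0; exact: measurable_ruin_before.
  - by move=> w ?; exists j.
have start Z : [set w | risk_process u c N Z 0 w = u] = setT.
  apply/seteqP; split => // w _; rewrite /= /risk_process.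
  by rewrite (poisson_process_start N_poisson) big_ord0 mulr0 addr0 subr0.
rewrite /ruin_probability /conditional_probability !start !setIT.
rewrite probability_setT divr1 divr1.
have m Z : measurable (ruin_event (risk_process u c N Z)).
  by rewrite ruin_event_bigcup; apply: bigcupT_measurable => j; exact: measurable_ruin_before.
by apply: fine_le => //; exact: fin_num_measure.
Qed.

End RuinComparison.

(** * The laws of the claims *)

Section NonnegativeClaims.
Context {R : realType} {d : measure_display} {T : measurableType d}.
Variable P : probability T R.

Lemma exponential_rv_lt0 (rate : R) (X : {RV P >-> R}) :
  exponential_rv rate X -> P [set w | X w < 0] = 0%E.
Proof.
move=> Xexp.
rewrite (_ : [set w | _] = X @^-1` `]-oo, 0[); last first.
  by apply/seteqP; split => w /=; rewrite in_itv.
rewrite -[LHS]/(distribution P X _) Xexp; last exact: measurable_itv.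
rewrite /exponential_prob integral0_eq// => x /=; rewrite in_itv/= => x0.
by rewrite lt0_exponential_pdf.
Qed.

End NonnegativeClaims.

Lemma erlang_rv_lt0 (R : realType) d (T : measurableType d) (P : probability T R)
    (p : nat) (rate : R) (X : {RV P >-> R}) :
  erlang_rv p rate X -> P [set w | X w < 0] = 0%E.
Proof.
move=> [d' [T' [P' [E [_ Eexp XE]]]]].
rewrite (_ : [set w | _] = X @^-1` `]-oo, 0[); last first.
  by apply/seteqP; split => w /=; rewrite in_itv.
rewrite -[LHS]/(distribution P X _) XE; last exact: measurable_itv.
have mS : measurable_fun setT (fun w => \sum_(j < p) E j w).
  exact: measurable_sum.
rewrite -(measure0 P').
apply: (@probability_eq_off_null _ _ _ P' (\bigcup_(j in [set` enum 'I_p])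
   [set w | E j w < 0])) => //.
- apply: fin_bigcup_measurable; first exact: finite_seq.
  by move=> j _; exact: measurable_lt0.
- rewrite bigcup_seq; apply: measure_negligible.
    by apply: bigsetU_measurable => j _; exact: measurable_lt0.
  elim/big_ind : _ => [|U V|j _]; [exact: negligible_set0|exact: negligibleU|].
  by apply/negligibleP; [exact: measurable_lt0|exact: exponential_rv_lt0].
- by rewrite -[X in measurable X]setTI; exact: mS.
move=> w nE; split => //; rewrite /= in_itv/= ltNge => /negP; apply.
apply: sumr_ge0 => j _; rewrite leNgt; apply/negP => Ej.
by apply: nE; exists j => //=; rewrite mem_enum.
Qed.

Section PhaseTypeClaimsLaw.
Context {R : realType} {d : measure_display} {T : measurableType d}.
Variable P : probability T R.
Variables (m : nat -> nat) (A : forall k, 'M[R]_(m k)).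
Variables (D : forall k, 'M[R]_(m k, m k.+1)) (alpha : 'rV[R]_(m 0%N)).
Hypothesis params : phase_type_parameters A D alpha.
Variable Y : nat -> {RV P >-> R}.
Hypothesis Y_claims : phase_type_claims A D alpha Y.

Lemma phase_type_claims_lt0 k : P [set w | Y k w < 0] = 0%E.
Proof.
have [d' [T' [P' [phi [phiP YE]]]]] := Y_claims (ltn0Sn k).
pose B : set (k.+1.-tuple (\bar R)) := [set v | (tnth v ord_max < 0)%E].
have mB : measurable B.
  rewrite /B -[X in measurable X]setTI; apply: measurable_lte => //.
  exact: measurable_tnth.
have := YE B mB.
rewrite [X in _ = X -> _](_ : _ = 0%E) => [<-|].
  congr (P _); apply/seteqP; split => w; rewrite /B/= tnth_mktuple lte_fin//.
rewrite (_ : _ @^-1` _ = set0) ?measure0//; apply/seteqP; split => // w.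
rewrite /B/= tnth_mktuple ltNge => /negP; apply.
by apply: integral_ge0 => s _; rewrite lee_fin.
Qed.

(** The deadlines only involve the claims through a measurable set of vectors, so
    they are transferred from the occupation times. *)
Lemma phase_type_claims_deadlines n (a : nat -> R) : (0 < n)%N ->
  (forall l, 0 <= a l) -> {homo a : i j / (i <= j)%N >-> i <= j} ->
  exists F : forall k, R -> 'I_(m k) -> R, [/\
    P (met_deadlines Y n a) = (\sum_i alpha 0 i * F 0%N 0 i)%:E,
    forall s j, F n s j = 1,
    forall k i, (k < n)%N -> F k (a k) i = 0,
    forall k i, (k < n)%N -> {within `[0, a k], continuous (F k ^~ i)} &
    forall k i s, (k < n)%N -> 0 <= s < a k -> is_derive s 1 (F k ^~ i)
      (- (\sum_j A k i j * F k s j) - \sum_j D k i j * F k.+1 s j)].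
Proof.
move=> n0 a0 amono; have [d' [T' [P' [phi [phiP YE]]]]] := Y_claims n0.
have [F [F1 F2 F3 F4 F5]] := phase_deadlines params n0 a0 amono phiP.
exists F; split => //; rewrite -F1 -(occupation_deadlines phiP a0).
pose B : set (n.-tuple (\bar R)) := [set v | forall l, (l < n)%N ->
  (\sum_(k < n | (k <= l)%N) tnth v k <= (a l)%:E)%E].
have mB : measurable B.
  apply: (@measurable_forall_lt _ _ n (fun l => [set v : n.-tuple (\bar R) |
    (\sum_(k < n | (k <= l)%N) tnth v k <= (a l)%:E)%E])) => l _.
  rewrite -[X in measurable X]setTI; apply: measurable_lee => //.
  rewrite (_ : (fun v => _) = (fun v : n.-tuple (\bar R) => \sum_(k < n)
      (if (k <= l)%N then tnth v k else 0))%E); last first.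
    by apply/funext => v; rewrite big_mkcond.
  apply: emeasurable_sum => k; case: (k <= l)%N => //.
  exact: measurable_tnth.
have BE (f : 'I_n -> \bar R) : B [tuple f k | k < n] <->
    forall l, (l < n)%N -> (\sum_(k < n | (k <= l)%N) f k <= (a l)%:E)%E.
  have E l : (\sum_(k < n | (k <= l)%N) tnth [tuple f k | k < n] k =
      \sum_(k < n | (k <= l)%N) f k)%E.
    by apply: eq_bigr => k _; rewrite tnth_mktuple.
  by split => h l ln; have := h l ln; rewrite E.
transitivity (P' ((fun w => [tuple occupation_time phi k w | k < n]) @^-1` B)).
  rewrite -YE//; congr (P _); apply/seteqP; split => w.
    move=> h; apply/BE => l ln; rewrite sumEFin lee_fin.
    by rewrite -(big_ord_widen _ (fun k => Y k w) ln); exact: h.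
  move=> /BE h l ln; have := h l ln; rewrite sumEFin lee_fin.
  by rewrite -(big_ord_widen _ (fun k => Y k w) ln).
by congr (P' _); apply/seteqP; split => w /BE.
Qed.

Lemma phase_type_claims_ge_exponential (nu : R) n (a : nat -> R) : (0 < n)%N ->
  (forall l, 0 <= a l) -> {homo a : i j / (i <= j)%N >-> i <= j} -> 0 < nu ->
  (forall k i, - (\sum_j A k i j) <= nu) ->
  (P (met_deadlines Y n a) <= (block_stages nu 1 n a 0)%:E)%E.
Proof.
move=> n0 a0 amono nu0 Anu.
have sa : 0 <= (0 : R) <= a 0%N by rewrite lexx a0.
have [F [-> F2 F3 F4 F5]] := phase_type_claims_deadlines n0 a0 amono.
have le i := phase_le_block_stages params amono F2 F3 F4 F5 nu0 Anu (addn0 n)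
  i sa.
rewrite lee_fin -[leRHS]mul1r -(ptp_initial_total params) mulr_suml.
apply: ler_sum => i _; rewrite ler_wpM2l ?(ptp_initial_nonnegative params)//.
have := le i.
by under [in X in block_stages _ _ _ X]eq_fun do rewrite addn0.
Qed.

Lemma phase_type_claims_le_erlang (sigma theta : R) p n (a : nat -> R) :
  (0 < n)%N -> (forall l, 0 <= a l) -> {homo a : i j / (i <= j)%N >-> i <= j} ->
  0 < sigma -> 0 < theta < 1 -> (0 < p)%N -> (forall k, (m k <= p)%N) ->
  (forall k (z : R[i]), dominating_eigenvalue (A k) z -> complex.Re z <= - sigma) ->
  ((block_stages sigma p n (fun l => theta * a l)%R 0)%:E <=
   P (met_deadlines Y n a))%E.
Proof.
move=> n0 a0 amono sigma0 theta01 p0 mp Asigma.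
have sa : 0 <= (0 : R) <= a 0%N by rewrite lexx a0.
have [F [-> F2 F3 F4 F5]] := phase_type_claims_deadlines n0 a0 amono.
have le i := block_stages_le_phase params amono F2 F3 F4 F5 sigma0 theta01 p0 mp
  Asigma (addn0 n) i sa.
rewrite lee_fin -[leLHS]mul1r -(ptp_initial_total params) mulr_suml.
apply: ler_sum => i _; rewrite ler_wpM2l ?(ptp_initial_nonnegative params)//.
have := le i; rewrite mulr0.
by under [in X in block_stages _ _ _ X]eq_fun do rewrite addn0.
Qed.

End PhaseTypeClaimsLaw.

Section ErlangLimit.
Context {R : realType} {d : measure_display} {T : measurableType d}.
Variable P : probability T R.

Lemma met_deadlines_block_stages (X : nat -> {RV P >-> R}) (p n : nat)
    (rate : R) (a : nat -> R) :
  0 < rate -> (0 < p)%N -> mutually_independent P (fun i => X i : T -> R) ->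
  (forall i, stage_law p rate (X i)) ->
  P (met_deadlines X n a) = (block_stages rate p n a 0)%:E.
Proof.
move=> rate0 p0 Xind Xlaw.
rewrite -(deadlines_block_stages 0 n a 0 rate0 p0 Xind Xlaw).
congr (P _); apply/seteqP; split => w h l ln; have := h l ln;
  by rewrite add0r add0n big_mkord.
Qed.

(** Meeting the deadlines (1 + 1 / (M + 1)) a_l for all M means meeting the
    deadlines a_l, and probabilities are continuous along decreasing events. *)
Lemma met_deadlines_right_continuous (X : nat -> {RV P >-> R}) (n : nat)
    (a : nat -> R) (b : \bar R) :
  (forall l, 0 <= a l) ->
  (forall M : nat, (b <= P (met_deadlines X n (fun l => (1 + M.+1%:R^-1) * a l)%R))%E) ->
  (b <= P (met_deadlines X n a))%E.
Proof.
move=> a0 bP; pose U M := met_deadlines X n (fun l => (1 + M.+1%:R^-1) * a l)%R.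
have UE : met_deadlines X n a = \bigcap_M U M.
  apply/seteqP; split => w h.
    move=> M _ l ln; apply: le_trans (h l ln) _.
    by rewrite ler_peMl// lerDl invr_ge0.
  move=> l ln; rewrite leNgt; apply/negP => aS.
  set S := \sum_(k < l.+1) X k w in aS.
  have e0 : 0 < S - a l by rewrite subr_gt0.
  pose M := Num.truncn (a l / (S - a l)).
  have := h M I l ln; apply/negP; rewrite -ltNge -/S mulrDl mul1r.
  rewrite -ltrBrDl mulrC ltr_pdivrMr// mulrC -ltr_pdivrMr//.
  have /andP[_] := truncn_itv (divr_ge0 (a0 l) (ltW e0)).
  exact.
have mU M : measurable (U M) by exact: measurable_met_deadlines.
have niU : nonincreasing_seq U.
  move=> M M' MM'; apply/subsetPset => w h l ln; apply: le_trans (h l ln) _.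
  by rewrite ler_wpM2r// lerD2l lef_pV2 ?posrE// ler_nat.
have mIU : measurable (\bigcap_M U M) by exact: bigcapT_measurable.
have U0fin : (P (U 0%N) < +oo)%E by rewrite ltey_eq fin_num_measure.
have cU := nonincreasing_cvg_mu U0fin mU mIU niU.
rewrite UE -(cvg_lim _ cU)//; apply: lime_ge.
  by apply/cvg_ex; eexists; exact: cU.
by apply: nearW => M; exact: bP.
Qed.

End ErlangLimit.

Theorem proposition3p6
  (R : realType) (d : measure_display) (T : measurableType d)
  (P : probability T R)
  (m : nat -> nat)
  (A : forall k : nat, 'M[R]_(m k))
  (D : forall k : nat, 'M[R]_(m k, m k.+1))
  (alpha : 'rV[R]_(m 0%N))
  (u c lambda nu sigma : R) (p : nat)
  (N : R -> T -> nat)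
  (Y L H : nat -> {RV P >-> R})
  (params : phase_type_parameters A D alpha)
  (u_ge0 : 0 <= u) (c_gt0 : 0 < c) (lambda_gt0 : 0 < lambda)
  (sigma_gt0 : 0 < sigma)
  (N_poisson : poisson_process P lambda N)
  (Y_claims : phase_type_claims A D alpha Y)
  (Y_indep_N : forall n : nat, (0 < n)%N ->
     independent_sigma_algebras P
       (process_sigma_algebra [set k : nat | (k < n)%N] (fun k => Y k : T -> R))
       (process_sigma_algebra [set t : R | 0 <= t] N))
  (A1 : forall k, (m k <= p)%N)
  (A2 : forall k (i : 'I_(m k)),
     (- (A k *m (const_mx 1 : 'cV[R]_(m k)))) i 0 <= nu)
  (A3 : forall k (z : R[i]),
     dominating_eigenvalue (A k) z -> complex.Re z <= - sigma)
  (L_exponential : forall i, exponential_rv nu (L i))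
  (L_indep : mutually_independent P (fun i => L i : T -> R))
  (L_indep_N : independent_sigma_algebras P
     (process_sigma_algebra [set: nat] (fun i => L i : T -> R))
     (process_sigma_algebra [set t : R | 0 <= t] N))
  (H_erlang : forall i, erlang_rv p sigma (H i))
  (H_indep : mutually_independent P (fun i => H i : T -> R))
  (H_indep_N : independent_sigma_algebras P
     (process_sigma_algebra [set: nat] (fun i => H i : T -> R))
     (process_sigma_algebra [set t : R | 0 <= t] N)) :
  ruin_probability P (risk_process u c N L) u
    <= ruin_probability P (risk_process u c N Y) u
  /\ ruin_probability P (risk_process u c N Y) u
    <= ruin_probability P (risk_process u c N H) u.

Proof.
have m0 : (0 < m 0%N)%N by exact: (ptp_nonempty params).
have p0 : (0 < p)%N by exact: leq_trans (A1 0%N).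
have Anu k i : - (\sum_j A k i j) <= nu.
  have := A2 k i; rewrite !mxE.
  by under eq_bigr do rewrite mxE mulr1.
(* If nu were not positive, A_0 1 would vanish, against the invertibility of A_0. *)
have nu0 : 0 < nu.
  rewrite ltNge; apply/negP => nu0.
  have A0 : A 0%N *m (const_mx 1 : 'cV[R]_(m 0%N)) = 0.
    apply/matrixP => i j; rewrite !mxE; under eq_bigr do rewrite mxE mulr1.
    apply/eqP; rewrite eq_le -oppr_ge0 -[X in _ && X]oppr_le0.
    rewrite (le_trans (Anu _ _) nu0) andbT (subgenerator_row params).
    by rewrite sumr_ge0// => l _; exact: (ptp_nonnegative params).
  have := mulKmx (ptp_transient params 0) (const_mx 1 : 'cV[R]_(m 0%N)).
  rewrite A0 mulmx0 => /matrixP/(_ (Ordinal m0) 0); rewrite !mxE => /eqP.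
  by rewrite eq_sym oner_eq0.
have counts_indep (X : nat -> {RV P >-> R}) : independent_sigma_algebras P
    (process_sigma_algebra [set: nat] (fun i => X i : T -> R))
    (process_sigma_algebra [set t : R | 0 <= t] N) ->
    independent_of_counts N X.
  move=> Xind n n0 U V XU NV; apply: Xind => //.
  move: XU; apply: smallest_sub; first exact: smallest_sigma_algebra.
  by move=> B [i _ Bi]; apply: sub_sigma_algebra; exists i.
have Y0 k := phase_type_claims_lt0 Y_claims k.
split.
- apply: (ruin_probability_le u_ge0 c_gt0 N_poisson (counts_indep _ L_indep_N)
    Y_indep_N _ Y0) => [k|n a n0 a0 amono]; first exact: exponential_rv_lt0.
  rewrite (met_deadlines_block_stages n a nu0 (ltnSn 0) L_indep); last first.
    by move=> i; exact: exponential_stage_law.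
  exact: (phase_type_claims_ge_exponential params Y_claims).
- apply: (ruin_probability_le u_ge0 c_gt0 N_poisson Y_indep_N
    (counts_indep _ H_indep_N) Y0) => [k|n a n0 a0 amono]; first exact: erlang_rv_lt0.
  rewrite (met_deadlines_block_stages n a sigma_gt0 p0 H_indep); last first.
    by move=> i; exact: erlang_stage_law.
  apply: met_deadlines_right_continuous => // M.
  (* Rate sigma / r and deadlines r a_l, or equivalently rate sigma and
     deadlines a_l. *)
  set r : R := 1 + M.+1%:R^-1.
  have r1 : 1 < r by rewrite /r ltrDl invr_gt0.
  have r0 : 0 < r by apply: lt_trans r1.
  have := @phase_type_claims_le_erlang _ _ _ P m A D alpha params Y Y_claims
    sigma r^-1 p n (fun l => r * a l) n0 _ _ sigma_gt0 _ p0 A1 A3.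
  under [in X in block_stages _ _ _ X]eq_fun do rewrite mulKf ?gt_eqF//.
  apply.
  + by move=> l; rewrite mulr_ge0// ltW.
  + by move=> i j ij; rewrite ler_wpM2l ?amono// ltW.
  + by rewrite invr_gt0 r0 invf_lt1.
Qed.
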